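(* Let $g=(g_1,\ldots,g_m)\in\mathcal V_r^m$, let $K=\{(x,\lambda)\in\mathbb R^n\times\mathbb R^r:g_i(x,\lambda)\ge0,\ i=1,\ldots,m\}$, and suppose that $\mathcal M_x(g)$ is restricted Archimedean. For real sequences $y=(y_\alpha)_{\alpha\in\mathbb N^n}$ and $z^{(k)}=(z^{(k)}_\alpha)_{\alpha\in\mathbb N^n}$, $k=1,\ldots,r$, the following statements are equivalent: (i) There is a Borel probability measure $\rho$ supported on $K$ such that $y_\alpha=\int_K x^\alpha\,d\rho(x,\lambda)$ and $z^{(k)}_\alpha=\int_K x^\alpha\lambda_k\,d\rho(x,\lambda)$ for every $\alpha\in\mathbb N^n$ and $k\in\{1,\ldots,r\}$. (ii) $y_0=1$ and $\mathcal L_{y,z}$ is nonnegative on $\mathcal M_x(g)$. (iii) $y_0=1$, $M(y)\succeq0$, and $M(g_i;y,z)\succeq0$ for $i=1,\ldots,m$. Whenever these conditions hold, there are a compactly supported Borel probability measure $\mu$ on $\mathbb R^n$ and functions $\tau_1,\ldots,\tau_r\in L^\infty(\mu)$ such that, for all $\alpha\in\mathbb N^n$ and $k\in\{1,\ldots,r\}$, $$y_\alpha=\int x^\alpha\,d\mu(x),\qquad z^{(k)}_\alpha=\int x^\alpha\tau_k(x)\,d\mu(x),$$ and $(x,\tau(x))\in K$ for $\mu$-almost every $x$, where $\tau=(\tau_1,\ldots,\tau_r)$. If $R,C_1,\ldots,C_r>0$ are such that $R-\|x\|^2\in\mathcal M_x(g)$ and $C_k\pm\lambda_k\in\mathcal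 M_x(g)$ for all $k$, the representatives may be chosen so that $|\tau_k|\le C_k$ $\mu$-almost everywhere. In particular, the pushforward $\rho$ of $\mu$ under the map $x\mapsto(x,\tau(x))$ is a representing measure, i.e. satisfies (i).
   Context: Here $x=(x_1,\ldots,x_n)$, $\lambda=(\lambda_1,\ldots,\lambda_r)$. $\mathcal V_r=\{p_0(x)+\sum_{k=1}^r\lambda_k p_k(x): p_0,\ldots,p_r\in\mathbb R[x]\}$. $\Sigma[x]$ is the cone of finite sums of squares in $\mathbb R[x]$. $\mathcal M_x(g)=\{\sigma_0+\sum_{i=1}^m\sigma_i g_i:\sigma_0,\ldots,\sigma_m\in\Sigma[x]\}$; it is restricted Archimedean if for every $p\in\mathcal V_r$ there is $N>0$ with $N+p,\ N-p\in\mathcal M_x(g)$. Write $g_i=g_{i0}+\sum_{k=1}^r\lambda_kg_{ik}$ with $g_{ik}=\sum_\gamma g_{ik,\gamma}x^\gamma\in\mathbb R[x]$. The linear functional $\mathcal L_{y,z}:\mathcal V_r\to\mathbb R$ is $\mathcal L_{y,z}(p_0+\sum_{k}\lambda_kp_k)=\sum_\alpha(p_0)_\alpha y_\alpha+\sum_{k=1}^r\sum_\alpha(p_k)_\alpha z^{(k)}_\alpha$, where $(p)_\alpha$ is the coefficient of $x^\alpha$ in $p$. The infinite moment matrix is $M(y)=(y_{\alpha+\beta})_{\alpha,\beta\in\mathbb N^n}$, and the restricted localizing matrix $M(g_i;y,z)$ is indexed by $\alpha,\beta\in\mathbb N^n$ with entries $\sum_\gamma g_{i0,\gamma}y_{\alpha+\beta+\gamma}+\sum_{k=1}^r\sum_\gamma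 g_{ik,\gamma}z^{(k)}_{\alpha+\beta+\gamma}$. An infinite symmetric matrix is positive semidefinite ($\succeq0$) when each of its finite principal submatrices is. *)

(* Defs.v *)
From HB Require Import structures.
From mathcomp Require Import all_boot all_order all_algebra.
(* The notations of mpoly clash with those of mathcomp-analysis. *)
From mathcomp Require Import (canonicals, coercions) mpoly.
From mathcomp Require Import all_classical all_reals all_analysis.

Set Implicit Arguments.
Unset Strict Implicit.
Unset Printing Implicit Defensive.

Import Order.TTheory GRing.Theory Num.Theory numFieldNormedType.Exports.

Local Open Scope classical_set_scope.
Local Open Scope ring_scope.

(* The space T with its Borel sigma-algebra, generated by the open sets. *)
Notation borel T := (g_sigma_algebraType (@open T)).

(* V_r as the free R[x]-module with basis 1, lambda_1, ..., lambda_r: the pair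
   (p0, \row_k p_k) stands for p0 + \sum_k lambda_k p_k. *)
Definition Vr (R : realType) (n r : nat) : Type :=
  ((mpoly.mpoly n R)^o * 'rV[mpoly.mpoly n R]_r)%type.

HB.instance Definition _ (R : realType) (n r : nat) :=
  GRing.Lmodule.copy (Vr R n r)
    ((mpoly.mpoly n R)^o * 'rV[mpoly.mpoly n R]_r)%type.

Section polynomials.
Variables (R : realType) (n r : nat).

Local Notation Rx := (mpoly.mpoly n R).
Local Notation mon := (mpoly.multinom n).
Local Notation Vr := (Vr R n r).

Definition in_Vr (p : Rx) : Vr := (p, 0).

Definition lam (k : 'I_r) : Vr := (0, delta_mx 0 k).

Definition evalx (p : Rx) (x : 'rV[R]_n) : R := mpoly.meval (x 0) p.

Definition evalV (p : Vr) (u : 'rV[R]_n * 'rV[R]_r) : R :=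
  evalx p.1 u.1 + \sum_(k < r) u.2 0 k * evalx (p.2 0 k) u.1.

Definition monx (a : mon) (x : 'rV[R]_n) : R :=
  \prod_(i < n) x 0 i ^+ a i.

Definition sqnormx : Rx := \sum_(i < n) mpoly.mpolyX R (mpoly.mnm1 i) ^+ 2.

Definition sos (s : Rx) : Prop :=
  exists qs : seq Rx, s = \sum_(q <- qs) q ^+ 2.

Definition feasible_set m (g : 'I_m -> Vr) : set ('rV[R]_n * 'rV[R]_r) :=
  [set u | forall i, 0 <= evalV (g i) u].

Definition quadratic_module m (g : 'I_m -> Vr) : set Vr :=
  [set p | exists (s0 : Rx) (s : 'I_m -> Rx),
    [/\ sos s0, forall i, sos (s i) & p = in_Vr s0 + \sum_(i < m) s i *: g i]].

Definition cstV (c : R) : Vr := in_Vr (mpoly.mpolyC n c).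

Definition restricted_archimedean m (g : 'I_m -> Vr) : Prop :=
  forall p : Vr, exists N : R,
    [/\ 0 < N, quadratic_module g (cstV N + p) & quadratic_module g (cstV N - p)].

Definition pairing (p : Rx) (y : mon -> R) : R :=
  \sum_(a <- mpoly.msupp p) mpoly.mcoeff a p * y a.

Definition Lyz (y : mon -> R) (z : 'I_r -> mon -> R) (p : Vr) : R :=
  pairing p.1 y + \sum_(k < r) pairing (p.2 0 k) (z k).

Definition moment_matrix (y : mon -> R) (a b : mon) : R := y (mpoly.mnm_add a b).

Definition localizing_matrix (gi : Vr) (y : mon -> R) (z : 'I_r -> mon -> R)
    (a b : mon) : R :=
  pairing gi.1 (fun c => y (mpoly.mnm_add (mpoly.mnm_add a b) c)) +
  \sum_(k < r)
    pairing (gi.2 0 k) (fun c => z k (mpoly.mnm_add (mpoly.mnm_add a b) c)).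

End polynomials.

Definition psd (R : realType) N (A : 'M[R]_N) : Prop :=
  A^T = A /\ forall v : 'cV[R]_N, 0 <= (v^T *m A *m v) 0 0.

(* A finite principal submatrix is given by listing distinct indices. *)
Definition psd_infinite (R : realType) (I : Type) (A : I -> I -> R) : Prop :=
  forall N (s : 'I_N -> I), injective s -> psd (\matrix_(i, j) A (s i) (s j)).

Definition has_integral d (T : measurableType d) (R : realType)
    (mu : {measure set T -> \bar R}) (D : set T) (f : T -> R) (v : R) : Prop :=
  mu.-integrable D (EFin \o f) /\ (\int[mu]_(x in D) (f x)%:E = v%:E)%E.

Section measures.
Variables (R : realType) (n r m : nat).
Variables (g : 'I_m -> Vr R n r).
Variables (y : mpoly.multinom n -> R) (z : 'I_r -> mpoly.multinom n -> R).

Definition representing_measure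
    (rho : probability (borel ('rV[R]_n * 'rV[R]_r)%type) R) : Prop :=
  [/\ rho (~` feasible_set g) = 0%E,
      forall a, has_integral rho (feasible_set g) (fun u => monx a u.1) (y a)
    & forall k a, has_integral rho (feasible_set g)
                    (fun u => monx a u.1 * u.2 0 k) (z k a)].

Definition compactly_supported (mu : probability (borel 'rV[R]_n) R) : Prop :=
  exists2 C : set 'rV[R]_n, compact C & mu (~` C) = 0%E.

Definition graph (tau : 'I_r -> borel 'rV[R]_n -> R) (x : borel 'rV[R]_n) :
    borel ('rV[R]_n * 'rV[R]_r)%type := (x, \row_k tau k x).

Definition graph_representation (mu : probability (borel 'rV[R]_n) R)
    (tau : 'I_r -> borel 'rV[R]_n -> R) : Prop :=
  [/\ compactly_supported mu,
      forall k, tau k \in Lfun mu +oo%E,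
      forall a, has_integral mu setT (monx a) (y a),
      forall k a, has_integral mu setT (fun x => monx a x * tau k x) (z k a)
    & {ae mu, forall x, feasible_set g (graph tau x)}].

End measures.

(* Main.v *)
(** Write L for the functional L_(y,z) and call u in V_r square-positive when
    L (q^2 u) >= 0 for all q in R[x]; statements (ii) and (iii) both say that 1 and
    the g_i are square-positive.

    The algebraic heart is that if p and C - p are square-positive polynomials and u
    is square-positive, then so is p u: after scaling to C = 1, the iterates
    a_(k+1) = a_k - a_k^2 of a_0 = p present p as a sum of squares plus a_k, and a_k
    tends to 0 in the L^2 seminorm.  So the polynomials t_i = (x_i + B_i) / (2 B_i) and
    1 - t_i can be multiplied freely.  For a word w of bits let b_w be the product of
    the corresponding factors t_i or 1 - t_i, where i runs cyclically through the
    coordinates.  The numbers L (b_w) >= 0 add up under refinement of w, hence they are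
    the law of a random sequence of bits, realized by nested intervals in [0, 1].
    Along this sequence the conditional means L (b_w x_i) / L (b_w) and
    L (b_w lambda_k) / L (b_w) are bounded martingales; a subsequence converges almost
    everywhere, to a random point (x, lambda).  The variance of the binomial law (as in
    Bernstein's proof of the Weierstrass theorem) shows that on average L (b_w p u) is
    close to p (x_w) L (b_w u), where x_w is the vector of conditional means.  In the
    limit (x, lambda) has the prescribed moments and satisfies g_i >= 0 almost
    everywhere, which proves (ii) => (i).

    Given a representing measure rho, take for mu its marginal on R^n and for tau_k the
    conditional expectation of lambda_k given x.  As g_i is affine in lambda,
    g_i (x, tau (x)) is the conditional expectation of g_i, hence nonnegative.  The
    bound |tau_k| <= C_k then holds for tau itself, since C_k + lambda_k and
    C_k - lambda_k are nonnegative on K. *)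

Require Import Defs.
From HB Require Import structures.
From mathcomp Require Import all_boot all_order all_algebra.
From mathcomp Require Import (canonicals, coercions) mpoly.
From mathcomp Require Import all_classical all_reals all_analysis.
From mathcomp Require Import measurable_realfun ess_sup_inf ring lra.

Set Implicit Arguments.
Unset Strict Implicit.
Unset Printing Implicit Defensive.

Import Order.TTheory GRing.Theory Num.Theory numFieldNormedType.Exports.

Local Open Scope classical_set_scope.
Local Open Scope ring_scope.

(** * Square-positive elements *)

Section positivity.
Variables (R : realType) (A : comAlgType R) (V : lmodType A).
Variable Lam : {additive V -> R}.
Hypothesis LamZ : forall (c : R) u, Lam (c%:A *: u) = c * Lam u.

(** The intended case is [A] = R[x], [V] = V_r and [Lam] = L_(y,z). Since [V] is a module over [A]
    only, real scalars act through [c%:A]. *)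
Definition sq_positive (u : V) := forall q : A, 0 <= Lam (q ^+ 2 *: u).

Lemma sq_positiveD u v : sq_positive u -> sq_positive v -> sq_positive (u + v).
Proof. by move=> hu hv q; rewrite scalerDr raddfD addr_ge0. Qed.

Lemma sq_positiveZ (c : R) u : 0 <= c -> sq_positive u -> sq_positive (c%:A *: u).
Proof.
by move=> c0 hu q; rewrite scalerA mulrC -scalerA LamZ mulr_ge0.
Qed.

Lemma sq_positive_sqr q u : sq_positive u -> sq_positive (q ^+ 2 *: u).
Proof. by move=> hu s; rewrite scalerA -exprMn. Qed.

Lemma sq_positive_ge0 u : sq_positive u -> 0 <= Lam u.
Proof. by move=> /(_ 1); rewrite expr1n scale1r. Qed.

Lemma sq_positive_sqrM q p u :
  sq_positive (p *: u) -> sq_positive ((q ^+ 2 * p) *: u).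
Proof. by move=> hu; rewrite -scalerA; apply: sq_positive_sqr. Qed.

Fixpoint logistic (p : A) k :=
  if k is k'.+1 then logistic p k' - logistic p k' ^+ 2 else p.

Lemma logistic_sum p k :
  p = \sum_(j < k) logistic p j ^+ 2 + logistic p k.
Proof.
elim: k => [|k IH]; first by rewrite big_ord0 add0r.
by rewrite big_ord_recr /= {1}IH; ring.
Qed.

(** Both a - a^2 and 1 - (a - a^2) are combinations of a and 1 - a with sums of squares as
    coefficients, so positivity passes along the iteration without multiplying two positive
    elements. *)
Lemma logistic_positive v p k :
  sq_positive (p *: v) -> sq_positive ((1 - p) *: v) ->
  sq_positive (logistic p k *: v) /\ sq_positive ((1 - logistic p k) *: v).
Proof.
move=> h0 h1; elim: k => [|k [IH0 IH1]] //=.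
set a := logistic p k in IH0 IH1 *; split.
- have -> : a - a ^+ 2 = a ^+ 2 * (1 - a) + (1 - a) ^+ 2 * a by ring.
  by rewrite scalerDl; apply: sq_positiveD; apply: sq_positive_sqrM.
- have -> : 1 - (a - a ^+ 2) = (1 - a) + a ^+ 2 * (1 - a) + a ^+ 2 * a by ring.
  rewrite 2!scalerDl.
  by apply: sq_positiveD; [apply: sq_positiveD => // |]; apply: sq_positive_sqrM.
Qed.

(** The squares of the iterates have total value at most [Lam (p *: v)], so they cannot all exceed
    [eps]. *)
Lemma logistic_small v p (eps : R) :
  sq_positive (p *: v) -> sq_positive ((1 - p) *: v) -> 0 < eps ->
  exists k, Lam (logistic p k ^+ 2 *: v) <= eps.
Proof.
move=> h0 h1 eps0; apply: contrapT => hN.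
have {}hN k : eps < Lam (logistic p k ^+ 2 *: v).
  by rewrite ltNge; apply/negP => hk; apply: hN; exists k.
have le_p k : k%:R * eps <= Lam (p *: v).
  rewrite [p in leRHS](logistic_sum p k) scalerDl raddfD /=.
  have [hk _] := logistic_positive k h0 h1.
  rewrite -[leLHS]addr0 lerD ?sq_positive_ge0//.
  rewrite scaler_suml raddf_sum /= -[k in leLHS]card_ord -sum1_card natr_sum mulr_suml.
  by apply: ler_sum => i _; rewrite mul1r ltW.
have := le_p (Num.trunc (Lam (p *: v) / eps)).+1.
by rewrite leNgt -ltr_pdivrMr// truncnS_gt.
Qed.

(* The iterates [a_(k+1) = a_k - a_k ^+ 2] write [p] as a sum of squares plus
   [a_k], and [Lam (a_k ^+ 2 *: u) <= Lam (a_k ^+ 2 *: v)] becomes small. *)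
Lemma Lam_scale_ge0 u v p : sq_positive u -> sq_positive (v - u) ->
  sq_positive (p *: v) -> sq_positive ((1 - p) *: v) -> 0 <= Lam (p *: u).
Proof.
move=> u0 uv p0 p1.
have lu := sq_positive_ge0 u0.
apply/ler_addgt0Pr => e e0.
have lu1 : 0 < 1 + Lam u by apply: ltr_pwDl.
(* This [d] satisfies d (1 + Lam u) = e. Positivity at (a + d)^2 together with Lam (a^2 u) <= Lam
   (a^2 v) <= d^2 then yields Lam (a u) >= - e / 2. *)
pose d := e / (1 + Lam u).
have d0 : 0 < d by apply: divr_gt0.
have d2 : 0 < d ^+ 2 by apply: exprn_gt0.
have [k hk] := logistic_small p0 p1 d2.
rewrite [p](logistic_sum p k) scalerDl raddfD /= scaler_suml raddf_sum /=.
have hs : 0 <= \sum_(i < k) Lam (logistic p i ^+ 2 *: u) by apply: sumr_ge0.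
set a := logistic p k in hk *.
have ha : Lam (a ^+ 2 *: u) <= Lam (a ^+ 2 *: v).
  by have := uv a; rewrite scalerBr raddfB subr_ge0.
have := u0 (a + d%:A).
have -> : (a + d%:A) ^+ 2 = a ^+ 2 + (2 * d)%:A * a + (d ^+ 2)%:A.
  by rewrite -!in_algE !(rmorphM, rmorphXn, rmorph_nat); ring.
rewrite 2!scalerDl -(scalerA (2 * d)%:A) 2!(raddfD Lam) 2!LamZ => h.
have hd : d * (1 + Lam u) = e by rewrite /d divfK// gt_eqF.
have hde : d ^+ 2 * (1 + Lam u) = d * e by rewrite expr2 -mulrA hd.
have : 0 <= d * (2 * Lam (a *: u) + e) by lra.
by rewrite pmulr_rge0// => ?; lra.
Qed.

(** All four hypotheses are stable under multiplication by q^2, so the scalar inequality applies to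
    q^2 u and q^2 v. *)
Lemma sq_positive_scale u v p : sq_positive u -> sq_positive (v - u) ->
  sq_positive (p *: v) -> sq_positive ((1 - p) *: v) -> sq_positive (p *: u).
Proof.
move=> u0 uv p0 p1 q; rewrite scalerA mulrC -scalerA.
apply: (@Lam_scale_ge0 _ (q ^+ 2 *: v)); first exact: sq_positive_sqr.
- by rewrite -scalerBr; apply: sq_positive_sqr.
- by rewrite scalerA mulrC -scalerA; apply: sq_positive_sqr.
- by rewrite scalerA mulrC -scalerA; apply: sq_positive_sqr.
Qed.

Variable e : V.
Hypothesis e_pos : sq_positive e.
Hypothesis arch : forall u, exists N : R, [/\ 0 < N,
  sq_positive (N%:A *: e + u) & sq_positive (N%:A *: e - u)].

(** The archimedean bound C for u makes C e a dominating vector, and the bound c for p e makes 1 - p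
    / c positive; [sq_positive_scale] then applies to p / c. *)
Lemma sq_positiveM p u :
  sq_positive (p *: e) -> sq_positive u -> sq_positive (p *: u).
Proof.
move=> p0 u0.
have [C [C0 _ hC]] := arch u.
have [c [c0 _ hc]] := arch (p *: e).
have pE : p = c%:A * (c^-1%:A * p).
  by rewrite mulrA -!in_algE -rmorphM mulfV ?gt_eqF// rmorph1 mul1r.
rewrite pE -scalerA; apply: sq_positiveZ; first exact: ltW.
(* The complement is (1 - p / c) C e = (C / c) (c e - p e), which is positive by the choice of c. *)
apply: (@sq_positive_scale _ (C%:A *: e)) => //.
- rewrite scalerA mulrC -!scalerA; do 2!(apply: sq_positiveZ; rewrite ?invr_ge0 ?ltW//).
- have -> : (1 - c^-1%:A * p) *: (C%:A *: e) = (C / c)%:A *: (c%:A *: e - p *: e).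
    rewrite -scalerBl !scalerA; congr (_ *: _).
    have h : c^-1%:A * c%:A = 1 :> A.
      by rewrite -!in_algE -rmorphM mulVf ?gt_eqF// rmorph1.
    have -> : (C / c)%:A = C%:A * c^-1%:A :> A by rewrite mulr_algl scalerA.
    by rewrite mulrBr -[C%:A * _ * _]mulrA h; ring.
  by apply: sq_positiveZ => //; rewrite divr_ge0 ?ltW.
Qed.

(* AM-GM, from the positivity of [(h + eps) ^+ 2 * b] and [(h - eps) ^+ 2 * b]
   against [N + u] and [N - u]. *)
Lemma Lam_AMGM (N eps : R) u b h :
  sq_positive (N%:A *: e + u) -> sq_positive (N%:A *: e - u) ->
  sq_positive (b *: e) ->
  2 * eps * `|Lam ((h * b) *: u)| <=
  N * (Lam ((h ^+ 2 * b) *: e) + eps ^+ 2 * Lam (b *: e)).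
Proof.
move=> hp hm hb.
have bp := sq_positiveM hb hp; have bm := sq_positiveM hb hm.
have E s t : Lam ((h + s%:A) ^+ 2 *: (b *: (N%:A *: e + t%:A *: u))) =
   N * (Lam ((h ^+ 2 * b) *: e) + 2 * s * Lam ((h * b) *: e)
        + s ^+ 2 * Lam (b *: e)) +
   t * (Lam ((h ^+ 2 * b) *: u) + 2 * s * Lam ((h * b) *: u)
        + s ^+ 2 * Lam (b *: u)).
  rewrite -!LamZ -!raddfD /= -!LamZ -raddfD /=; congr (Lam _).
  rewrite !scalerDr !scalerA -!scalerDl.
  congr (_ *: _ + _ *: _);
  by rewrite -!in_algE !(rmorphM, rmorphXn, rmorph_nat); ring.
have E1 x : N%:A *: e + x = N%:A *: e + 1%:A *: x by rewrite !scale1r.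
have E2 x : N%:A *: e - x = N%:A *: e + (-1)%:A *: x.
  by rewrite !scaleN1r.
rewrite E1 in bp; rewrite E2 in bm.
(* Adding two instances of [E] in which both signs are opposite cancels everything except the
   right-hand side and the cross term Lam (h b u). *)
have := bp (h + eps%:A); have := bm (h + (- eps)%:A).
have := bp (h + (- eps)%:A); have := bm (h + eps%:A).
rewrite !E => i1 i2 i3 i4.
have [_|_] := ger0P (Lam ((h * b) *: u)); lra.
Qed.

End positivity.

(** * The tree of products of t and 1 - t *)

(** Words grow at their right end, so that [take N w] is the ancestor of [w] at level [N]. *)
Fixpoint words N : seq (seq bool) :=
  if N is N'.+1 then
    [seq rcons w true | w <- words N'] ++ [seq rcons w false | w <- words N']
  else [:: [::]].

Lemma size_words N w : w \in words N -> size w = N.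
Proof.
elim: N w => [|N IH] w /=; first by rewrite inE => /eqP ->.
by rewrite mem_cat => /orP[] /mapP[v /IH vN ->]; rewrite size_rcons vN.
Qed.

Lemma mem_words w : w \in words (size w).
Proof.
elim/last_ind: w => [|w b IH] //; rewrite size_rcons /= mem_cat.
by case: b; apply/orP; [left|right]; apply: map_f.
Qed.

Lemma uniq_words N : uniq (words N).
Proof.
elim: N => [|N IH] //=; rewrite cat_uniq !map_inj_uniq ?IH /= ?andbT.
- by apply/hasPn => _ /mapP[v _ ->]; apply/mapP => -[u _ /rcons_inj[]].
- by move=> u v /rcons_inj[].
- by move=> u v /rcons_inj[].
Qed.

Lemma sum_words (Z : nmodType) N (F : seq bool -> Z) :
  \sum_(w <- words N.+1) F w =
  \sum_(w <- words N) (F (rcons w true) + F (rcons w false)).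
Proof. by rewrite /= big_cat !big_map big_split. Qed.

Section tree.
Variables (R : realType) (A : comAlgType R) (V : lmodType A).
Variable Lam : {additive V -> R}.
Hypothesis LamZ : forall (c : R) u, Lam (c%:A *: u) = c * Lam u.
Variable e : V.
Hypothesis e_pos : sq_positive Lam e.
Hypothesis e1 : Lam e = 1.
Hypothesis arch : forall u, exists N : R, [/\ 0 < N,
  sq_positive Lam (N%:A *: e + u) & sq_positive Lam (N%:A *: e - u)].
Variable f : nat -> A.
Hypothesis f_pos : forall j, sq_positive Lam (f j *: e).
Hypothesis f_pos1 : forall j, sq_positive Lam ((1 - f j) *: e).

Definition branch (w : seq bool) : A :=
  \prod_(j < size w) (if nth false w j then f j else 1 - f j).

Lemma branch_rcons w b :
  branch (rcons w b) = branch w * (if b then f (size w) else 1 - f (size w)).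
Proof.
rewrite /branch size_rcons big_ord_recr /= nth_rcons ltnn eqxx; congr (_ * _).
by apply: eq_bigr => i _; rewrite nth_rcons ltn_ord.
Qed.

Lemma branch_split w : branch (rcons w true) + branch (rcons w false) = branch w.
Proof. by rewrite !branch_rcons -mulrDr addrC subrK mulr1. Qed.

Lemma branch_nil : branch [::] = 1.
Proof. by rewrite /branch big_ord0. Qed.

Lemma branch_pos w : sq_positive Lam (branch w *: e).
Proof.
elim/last_ind: w => [|w b IH]; first by rewrite branch_nil scale1r.
rewrite branch_rcons -scalerA.
by apply: (sq_positiveM LamZ arch) => //; case: b.
Qed.

(** The children of a word share out its product as t + (1 - t), so each level is a partition of
    unity. *)
Lemma sum_branch N : \sum_(w <- words N) branch w = 1.
Proof.
elim: N => [|N IH]; first by rewrite big_seq1 branch_nil.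
by rewrite sum_words -{}[RHS]IH; apply: eq_bigr => w _; rewrite branch_split.
Qed.

Definition mass u w := Lam (branch w *: u).
Definition mean u w := mass u w / mass e w.

Lemma mass_split u w : mass u (rcons w true) + mass u (rcons w false) = mass u w.
Proof. by rewrite /mass -raddfD -scalerDl branch_split. Qed.

Lemma mass_ge0 u w : sq_positive Lam u -> 0 <= mass u w.
Proof.
move=> u0; apply: sq_positive_ge0; apply: (sq_positiveM LamZ arch) => //.
exact: branch_pos.
Qed.

Lemma sum_mass u N : \sum_(w <- words N) mass u w = Lam u.
Proof. by rewrite -raddf_sum -scaler_suml sum_branch scale1r. Qed.

Lemma mass_bound (N : R) u w :
  sq_positive Lam (N%:A *: e + u) -> sq_positive Lam (N%:A *: e - u) ->
  `|mass u w| <= N * mass e w.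
Proof.
move=> /(mass_ge0 w) h1 /(mass_ge0 w) h2; move: h1 h2.
rewrite /mass scalerDr scalerBr raddfD raddfB /= !scalerA mulrC -scalerA LamZ.
by move=> h1 h2; rewrite ler_norml; apply/andP; split; lra.
Qed.

(** This covers branches of mass zero, where the quotient [mean] is 0 by convention: by
    [mass_bound], [mass u w] vanishes there as well. *)
Lemma mean_mass u w : mean u w * mass e w = mass u w.
Proof.
have [N [_ h1 h2]] := arch u; have := mass_bound w h1 h2.
have [->|m0 _] := eqVneq (mass e w) 0; last by rewrite divfK.
by rewrite !mulr0 normr_le0 => /eqP.
Qed.

Lemma mean_bound (N : R) u w : 0 <= N ->
  sq_positive Lam (N%:A *: e + u) -> sq_positive Lam (N%:A *: e - u) ->
  `|mean u w| <= N.
Proof.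
move=> N0 h1 h2; have := mass_bound w h1 h2.
have := mass_ge0 w e_pos; rewrite /mean le_eqVlt => /orP[/eqP<-|m0].
  by rewrite invr0 !mulr0 normr0.
by rewrite normrM normfV (gtr0_norm m0) ler_pdivrMr.
Qed.

Lemma ex_mean_bound u : exists2 c : R, 0 < c & forall w, `|mean u w| <= c.
Proof.
have [N [N0 h1 h2]] := arch u.
by exists N => // w; apply: mean_bound => //; apply: ltW.
Qed.

(** * Second moments of the martingale of conditional means *)

Section energy.
Variable u : V.

Definition energy N := \sum_(w <- words N) mass e w * mean u w ^+ 2.

(** The squared L^2 distance between the martingale at levels [N] and [M], a word of length [M]
    being compared with its ancestor of length [N]. *)
Definition increment N M :=
  \sum_(w <- words M) mass e w * (mean u w - mean u (take N w)) ^+ 2.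

Lemma increment_ge0 N M : 0 <= increment N M.
Proof. by apply: sumr_ge0 => w _; rewrite mulr_ge0 ?sqr_ge0 ?mass_ge0. Qed.

(* The conditional means form a martingale, so increments are orthogonal. *)
Lemma incrementE N M : (N <= M)%N -> increment N M = energy M - energy N.
Proof.
elim: M => [|M IH].
  rewrite leqn0 => /eqP ->; rewrite subrr /increment big_seq1.
  by rewrite take0 subrr expr0n mulr0.
rewrite leq_eqVlt => /orP[/eqP->|].
  rewrite subrr /increment big_seq_cond big1// => w /andP[/size_words wM _].
  by rewrite -wM take_size subrr expr0n mulr0.
rewrite ltnS => NM; have {}IH := IH NM.
suff: increment N M.+1 - increment N M = energy M.+1 - energy M by lra.
rewrite /increment /energy !sum_words -!sumrB; apply: eq_big_seq => w.
move=> /size_words wM.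
rewrite -!cats1 !takel_cat ?wM// !cats1.
set t := mean u (take N w).
(* The terms containing [t] involve only [mass u] and [mass e], which are additive under splitting;
   hence they cancel between [w] and its two children. *)
have E v : mass e v * (mean u v - t) ^+ 2 =
    mass e v * mean u v ^+ 2 - 2 * t * mass u v + t ^+ 2 * mass e v.
  by rewrite -(mean_mass u v); ring.
by rewrite !E -(mass_split u w) -(mass_split e w); ring.
Qed.

Lemma energy_nondecreasing : nondecreasing_seq energy.
Proof.
by move=> N M NM; rewrite -subr_ge0 -incrementE// increment_ge0.
Qed.

Lemma energy_ub : exists c, forall N, energy N <= c.
Proof.
have [c c0 hc] := ex_mean_bound u; exists (c ^+ 2) => N.
rewrite -[leRHS]mulr1 -[X in _ * X]e1 -(sum_mass e N) mulr_sumr.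
apply: ler_sum => w _; rewrite mulrC ler_wpM2r ?mass_ge0//.
by rewrite -real_normK ?num_real// lerXn2r ?nnegrE// ltW.
Qed.

Lemma energy_cvg : cvgn energy.
Proof.
apply: nondecreasing_is_cvgn; first exact: energy_nondecreasing.
have [c hc] := energy_ub; exists c => _ [N _ <-]; exact: hc.
Qed.

End energy.

(** The squared distance, in the seminorm given by [Lam], between [p] and the step function equal to
    [P w] on the branch [w]. *)
Definition deviation N p (P : seq bool -> R) :=
  \sum_(w <- words N) Lam (((p - (P w)%:A) ^+ 2 * branch w) *: e).

Lemma deviation_ge0 N p P : 0 <= deviation N p P.
Proof. by apply: sumr_ge0 => w _; rewrite -scalerA; exact: branch_pos. Qed.

(** * The binomial law along the positions that carry a given factor *)

Section bernstein.
Variables (t : A) (J : pred nat).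
Hypothesis fJ : forall j, J j -> f j = t.

Definition trials N := (\sum_(j < N) J j)%N.
Definition hits (w : seq bool) := (\sum_(j < size w) (J j && nth false w j))%N.

Lemma hits_rcons w b : hits (rcons w b) = (hits w + (J (size w) && b))%N.
Proof.
rewrite /hits size_rcons big_ord_recr /= nth_rcons ltnn eqxx; congr (_ + _)%N.
by apply: eq_bigr => i _; rewrite nth_rcons ltn_ord.
Qed.

(* The variance of the binomial distribution of parameter [t]. *)
Lemma bernstein_variance N :
  \sum_(w <- words N) ((trials N)%:R * t - (hits w)%:R) ^+ 2 * branch w =
  (trials N)%:R * (t * (1 - t)).
Proof.
elim: N => [|N IH].
  by rewrite big_seq1 /trials /hits !big_ord0 !mul0r subr0 expr0n mul0r.
have -> : trials N.+1 = (trials N + J N)%N by rewrite /trials big_ord_recr.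
rewrite sum_words natrD [in RHS]mulrDl -{}IH.
have -> : (J N)%:R * (t * (1 - t)) =
    \sum_(w <- words N) branch w * ((J N)%:R * (t * (1 - t))).
  by rewrite -mulr_suml sum_branch mul1r.
rewrite -big_split /=.
apply: eq_big_seq => w /size_words wN.
rewrite !hits_rcons !branch_rcons wN andbT andbF addn0 !natrD.
by case JN: (J N) => /=; rewrite ?(fJ JN); ring.
Qed.

Hypothesis trials_infty : forall K, \forall N \near \oo, (K <= trials N)%N.

(** On each branch the conditional mean minimizes the squared deviation among constants. It
    therefore does at least as well as the observed frequency of hits, whose error is the binomial
    variance, of order 1 / [trials]. *)
Lemma deviation_mean (a b : R) :
  (fun N => deviation N (a%:A + b%:A * t) (mean ((a%:A + b%:A * t) *: e)))
    @ \oo --> (0 : R).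
Proof.
set x := a%:A + b%:A * t.
pose c0 := b ^+ 2 * Lam ((t * (1 - t)) *: e).
have le_dev N : (0 < trials N)%N ->
    deviation N x (mean (x *: e)) <= c0 * (trials N)%:R^-1.
  move=> N0; set s : R := (trials N)%:R.
  have s0 : 0 < s by rewrite ltr0n.
  (* The competitor: [t] is estimated by the proportion of hits among the trials. *)
  pose y (w : seq bool) := a + b * (hits w)%:R / s.
  have -> : c0 * s^-1 = deviation N x y.
    rewrite /deviation -raddf_sum /= -scaler_suml.
    have E w : (x - (y w)%:A) ^+ 2 * branch w = ((b / s) ^+ 2)%:A *
        (((trials N)%:R * t - (hits w)%:R) ^+ 2 * branch w).
      have -> : x - (y w)%:A = (b / s)%:A * ((trials N)%:R * t - (hits w)%:R).
        rewrite /x /y -!in_algE !(rmorphD, rmorphM, rmorph_nat).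
        have h : in_alg A s^-1 * (trials N)%:R = 1.
          by rewrite -(rmorph_nat (in_alg A)) -rmorphM mulVf ?gt_eqF// rmorph1.
        transitivity (in_alg A b * (in_alg A s^-1 * (trials N)%:R) * t -
           in_alg A b * (hits w)%:R * in_alg A s^-1); last by ring.
        by rewrite h; ring.
      by rewrite -!in_algE rmorphXn; ring.
    under eq_bigr do rewrite E.
    rewrite -mulr_sumr bernstein_variance -scalerA LamZ.
    have -> : (trials N)%:R = s%:A :> A by rewrite -in_algE rmorph_nat.
    rewrite -scalerA LamZ /c0.
    by field; rewrite gt_eqF.
  (* As a function of the constant c the deviation on [w] is quadratic, with its minimum at the mean
     [z]; the excess at [y w] is mass times (y w - z)^2. *)
  apply: ler_sum => w _; set z := mean _ w.
  have E (c : R) : Lam (((x - c%:A) ^+ 2 * branch w) *: e) =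
     Lam ((x ^+ 2 * branch w) *: e) - 2 * c * (z * mass e w) + c ^+ 2 * mass e w.
    rewrite mean_mass /mass scalerA -!LamZ -raddfB -raddfD /=; congr (Lam _).
    rewrite !scalerA -scalerBl -scalerDl; congr (_ *: _).
    by rewrite -!in_algE !(rmorphM, rmorphXn, rmorph_nat); ring.
  rewrite !E -subr_ge0.
  set m := mass e w; set X := Lam _.
  have -> : X - 2 * y w * (z * m) + y w ^+ 2 * m -
    (X - 2 * z * (z * m) + z ^+ 2 * m) = m * (y w - z) ^+ 2 by ring.
  by rewrite mulr_ge0 ?sqr_ge0 ?mass_ge0.
have inv0 : (fun N => c0 * (trials N)%:R^-1) @ \oo --> (0 : R).
  rewrite -[X in _ --> X](mulr0 c0); apply: cvgM; first exact: cvg_cst.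
  apply/cvgrPdist_le => eps eps0; near=> N.
  have hN : ((Num.trunc eps^-1).+1 <= trials N)%N by near: N; exact: trials_infty.
  rewrite sub0r normrN ger0_norm ?invr_ge0// -[leRHS]invrK lef_pV2 ?posrE ?invr_gt0//.
    by rewrite (le_trans (ltW (truncnS_gt _)))// ler_nat.
  by rewrite ltr0n (leq_trans _ hN).
apply: (squeeze_cvgr _ (cvg_cst 0) inv0); near=> N.
rewrite deviation_ge0 /= le_dev//; near: N; exact: trials_infty.
Unshelve. all: by end_near. Qed.

End bernstein.


(** * Polynomials approximated by bounded functions of words *)

Definition approximable p P :=
  (exists c, forall w, `|P w| <= c) /\ (fun N => deviation N p P) @ \oo --> (0 : R).

(** By the parallelogram identity the difference of the two sides is the value at (x - y)^2 b. *)
Lemma Lam_sqrD_le b x y : sq_positive Lam (b *: e) ->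
  Lam (((x + y) ^+ 2 * b) *: e) <=
  2 * Lam ((x ^+ 2 * b) *: e) + 2 * Lam ((y ^+ 2 * b) *: e).
Proof.
move=> /(_ (x - y)) h; rewrite -subr_ge0; apply: le_trans h _.
rewrite -!LamZ -raddfD -raddfB /= le_eqVlt; apply/orP; left; apply/eqP.
congr (Lam _); rewrite !scalerA -scalerDl -scalerBl; congr (_ *: _).
by rewrite -!in_algE !rmorph_nat; ring.
Qed.

Lemma approximable_cst c : approximable c%:A (fun=> c).
Proof.
split; first by exists `|c|.
rewrite (_ : (fun _ => _) = (fun=> 0)); first exact: cvg_cst.
apply/funext => N; rewrite /deviation big1// => w _.
by rewrite subrr expr0n mul0r scale0r raddf0.
Qed.

Lemma approximableD p P q Q : approximable p P -> approximable q Q ->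
  approximable (p + q) (fun w => P w + Q w).
Proof.
move=> [[c hc] hp] [[d hd] hq]; split.
  by exists (c + d) => w; rewrite (le_trans (ler_normD _ _))// lerD.
have hpq : (fun N => 2 * deviation N p P + 2 * deviation N q Q) @ \oo --> (0 : R).
  rewrite -[X in _ --> X](addr0 (0 : R)) -[X in _ --> X + X](mulr0 2).
  by apply: cvgD; apply: cvgM => //; exact: cvg_cst.
apply: (squeeze_cvgr _ (cvg_cst 0) hpq); near=> N.
rewrite deviation_ge0 /= /deviation !mulr_sumr -big_split /=.
apply: ler_sum => w _; apply: le_trans (Lam_sqrD_le _ _ (branch_pos w)).
rewrite le_eqVlt; apply/orP; left; apply/eqP; congr (Lam ((_ ^+ 2 * _) *: _)).
by rewrite -!in_algE rmorphD; ring.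
Unshelve. all: by end_near. Qed.

(** Write p q - P Q = p (q - Q) + Q (p - P). The factor p^2 is controlled by the archimedean bound
    on p^2 e, and Q by its boundedness, which is why [approximable] includes a bound. *)
Lemma approximableM p P q Q : approximable p P -> approximable q Q ->
  approximable (p * q) (fun w => P w * Q w).
Proof.
move=> [[c hc] hp] [[d hd] hq]; split.
  by exists (c * d) => w; rewrite normrM ler_pM.
have [C [C0 _ hC]] := arch (p ^+ 2 *: e).
have hpq : (fun N => 2 * C * deviation N q Q + 2 * d ^+ 2 * deviation N p P)
    @ \oo --> (0 : R).
  rewrite -[X in _ --> X](addr0 (0 : R)) -[X in _ --> X + _](mulr0 (2 * C)).
  rewrite -[X in _ --> _ + X](mulr0 (2 * d ^+ 2)).
  by apply: cvgD; apply: cvgM => //; exact: cvg_cst.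
apply: (squeeze_cvgr _ (cvg_cst 0) hpq); near=> N.
rewrite deviation_ge0 /= /deviation !mulr_sumr -big_split /=.
apply: ler_sum => w _.
have -> : p * q - (P w * Q w)%:A =
    p * (q - (Q w)%:A) + (Q w)%:A * (p - (P w)%:A).
  by rewrite -!in_algE rmorphM; ring.
apply: le_trans (Lam_sqrD_le _ _ (branch_pos w)) _; apply: lerD.
  rewrite -[leRHS]mulrA ler_pM2l// -LamZ -subr_ge0 -raddfB /=.
  have := sq_positiveM LamZ arch (branch_pos w) hC (q - (Q w)%:A).
  rewrite -scalerBl !scalerA -scalerBl => h; apply: le_trans h _.
  rewrite le_eqVlt; apply/orP; left; apply/eqP; congr (Lam (_ *: _)).
  by ring.
rewrite -[leRHS]mulrA ler_pM2l//.
have -> : ((Q w)%:A * (p - (P w)%:A)) ^+ 2 * branch w =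
    (Q w ^+ 2)%:A * ((p - (P w)%:A) ^+ 2 * branch w).
  by rewrite -!in_algE rmorphXn; ring.
rewrite -(scalerA (Q w ^+ 2)%:A) LamZ ler_wpM2r//.
  by rewrite -scalerA; exact: branch_pos.
have d0 : 0 <= d := le_trans (normr_ge0 _) (hd w).
by rewrite -[Q w ^+ 2]real_normK ?num_real// lerXn2r ?nnegrE.
Unshelve. all: by end_near. Qed.

(** [Lam_AMGM] with h = p - P w, summed over the words, bounds a first-order error by the deviation,
    a second-order one. *)
Lemma approximable_mass p P u : approximable p P ->
  (fun N => \sum_(w <- words N) `|mass (p *: u) w - P w * mass u w|)
    @ \oo --> (0 : R).
Proof.
move=> [_ hP]; have [C [C0 h1 h2]] := arch u.
have hM w : mass (p *: u) w - P w * mass u w =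
    Lam (((p - (P w)%:A) * branch w) *: u).
  rewrite /mass scalerA -LamZ scalerA -raddfB -scalerBl mulrBl.
  by rewrite [p * _]mulrC.
have bound N (eps : R) : 0 < eps -> 2 * eps *
    (\sum_(w <- words N) `|mass (p *: u) w - P w * mass u w|) <=
    C * (deviation N p P + eps ^+ 2).
  move=> eps0; rewrite -[eps ^+ 2]mulr1 -[X in _ + _ * X]e1 -(sum_mass e N).
  rewrite /deviation [eps ^+ 2 * _]mulr_sumr -big_split /= !mulr_sumr.
  apply: ler_sum => w _; rewrite hM.
  by apply: (Lam_AMGM LamZ arch) => //; exact: branch_pos.
apply/cvgrPdist_le => eps eps0.
(* At parameter eps / C and with deviation at most (eps / C)^2, [bound] reads 2 (eps / C) S <= 2 C
   (eps / C)^2 for the sum S in question, that is, S <= eps. *)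
have d0 : 0 < eps / C by apply: divr_gt0.
move/cvgrPdist_le: hP => /(_ ((eps / C) ^+ 2)) hP.
near=> N.
rewrite sub0r normrN ger0_norm ?sumr_ge0//.
rewrite -(ler_pM2l (mulr_gt0 (ltr0Sn _ 1) d0)); apply: le_trans (bound _ _ d0) _.
have hN : deviation N p P <= (eps / C) ^+ 2.
  have : `|0 - deviation N p P| <= (eps / C) ^+ 2.
    by near: N; apply: hP; rewrite exprn_gt0.
  by rewrite sub0r normrN ger0_norm ?deviation_ge0.
have -> : 2 * (eps / C) * eps = C * ((eps / C) ^+ 2 + (eps / C) ^+ 2).
  by field; rewrite gt_eqF.
by rewrite ler_pM2l// lerD2r.
Unshelve. all: by end_near. Qed.

End tree.

(** * Random words and their limits *)

Section random_words.
Variables (R : realType) (m : seq bool -> R).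
Hypothesis m_ge0 : forall w, 0 <= m w.
Hypothesis m_nil : m [::] = 1.
Hypothesis m_split : forall w, m (rcons w true) + m (rcons w false) = m w.

Local Notation Omega := (measurableTypeR R).
Local Notation P := (uniform_prob (@ltr01 R)).

(** The total mass of the words of the same length that precede [w] lexicographically, with false
    before true. *)
Definition left_end (w : seq bool) : R :=
  \sum_(j < size w) (if nth false w j then m (rcons (take j w) false) else 0).

Lemma left_end_rcons w b :
  left_end (rcons w b) = left_end w + (if b then m (rcons w false) else 0).
Proof.
have tk j : (j <= size w)%N -> take j (rcons w b) = take j w.
  by move=> jw; rewrite -cats1 takel_cat.
rewrite /left_end size_rcons big_ord_recr /= nth_rcons ltnn eqxx tk// take_size.
congr (_ + _); apply: eq_bigr => i _.
by rewrite nth_rcons ltn_ord tk// ltnW.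
Qed.

(* The word of length [N] whose interval
   [left_end w <= omega < left_end w + m w] contains [omega]. *)
Fixpoint random_word N (omega : Omega) : seq bool :=
  if N is N'.+1 then
    let w := random_word N' omega in
    rcons w (left_end w + m (rcons w false) <= omega)
  else [::].

Lemma size_random_word N omega : size (random_word N omega) = N.
Proof. by elim: N => //= N IH; rewrite size_rcons IH. Qed.

Lemma take_random_word N M omega : (N <= M)%N ->
  take N (random_word M omega) = random_word N omega.
Proof.
elim: M => [|M IH]; first by rewrite leqn0 => /eqP ->.
rewrite leq_eqVlt => /orP[/eqP ->|NM].
  by rewrite -{1}(size_random_word M.+1 omega) take_size.
by rewrite /= -cats1 takel_cat ?size_random_word// IH.
Qed.

Lemma random_word_preimage N w b :
  random_word N.+1 @^-1` [set rcons w b] = random_word N @^-1` [set w] `&`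
  [set omega | (left_end w + m (rcons w false) <= omega) = b].
Proof.
apply/seteqP; split => omega /=.
  by move=> /rcons_inj[-> <-].
by move=> [-> ->].
Qed.

Lemma measurable_random_word N w :
  measurable (random_word N @^-1` [set w] : set Omega).
Proof.
elim: N w => [|N IH] w.
  have [->|w0] := eqVneq w [::].
    by rewrite (_ : _ @^-1` _ = setT)//; apply/seteqP; split.
  rewrite (_ : _ @^-1` _ = set0)//; apply/seteqP; split => //= x /esym/eqP.
  by rewrite (negbTE w0).
elim/last_ind: w => [|w b _].
  rewrite (_ : _ @^-1` _ = set0)//; apply/seteqP; split => //= x /(congr1 size).
  by rewrite size_rcons.
rewrite random_word_preimage; apply: measurableI => //.
set c := _ + _; case: b.
  rewrite (_ : [set _ | _] = `[c, +oo[%classic)//.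
  by apply/seteqP; split => x /=; rewrite in_itv /= andbT.
rewrite (_ : [set _ | _] = `]-oo, c[%classic)//.
apply/seteqP; split => x /=; rewrite in_itv /= ltNge; first by move=> ->.
by move=> /negbTE.
Qed.

(** By induction, the interval of [w] is cut at [left_end w + m (rcons w false)]. The intersection
    with [0, 1[ matters: points to its left get the word of all false, points to its right the word
    of all true. *)
Lemma random_word_itv N w : size w = N ->
  random_word N @^-1` [set w] `&` `[0, 1[ = `[left_end w, left_end w + m w[%classic.
Proof.
elim: N w => [|N IH] w.
  move=> /size0nil ->; rewrite m_nil /left_end big_ord0 add0r.
  by apply/seteqP; split => x //= [].
elim/last_ind: w => [|w b _]; first by [].
rewrite size_rcons => -[wN]; rewrite random_word_preimage setIAC IH//.
rewrite left_end_rcons; have := m_split w.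
have := m_ge0 (rcons w true); have := m_ge0 (rcons w false).
case: b => h1 h2 h3; apply/seteqP; split => x /=; rewrite !in_itv /=.
- by move=> [/andP[x1 x2] ->] /=; lra.
- by move=> /andP[x1 x2]; split => //; lra.
- move=> [/andP[x1 x2] /negbT]; rewrite -ltNge => ?; lra.
- move=> /andP[x1 x2]; split; first by lra.
  by apply/negbTE; rewrite -ltNge; lra.
Qed.

Lemma probability_random_word N w : size w = N ->
  P (random_word N @^-1` [set w]) = (m w)%:E.
Proof.
move=> wN; have mw := @measurable_random_word N w.
have -> : P (random_word N @^-1` [set w]) =
    (\int[P]_x (\1_(random_word N @^-1` [set w]) x)%:E)%E.
  by rewrite integral_indic// setIT.
rewrite integral_uniform//; last exact/measurable_EFinP/measurable_indic.
(* The endpoint 1 is dropped, since the intervals of words are half-open. *)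
rewrite subr0 invr1 mul1e -integral_itv_bndo_bndc; last first.
  exact/measurable_EFinP/measurable_indic.
rewrite integral_indic//= (random_word_itv wN) lebesgue_measure_itv /= lte_fin.
rewrite ltrDl; case: ltP => [_|m0]; first by rewrite -EFinB addrC addKr.
by congr (_%:E); apply/eqP; rewrite eq_le m0 m_ge0.
Qed.

(** A function of the random word is a finite combination of indicators, which yields both its
    measurability and its integral. *)
Lemma random_wordE N (F : seq bool -> R) omega :
  F (random_word N omega) =
  \sum_(w <- words N) F w * \1_(random_word N @^-1` [set w]) omega.
Proof.
rewrite (bigD1_seq (random_word N omega)) ?uniq_words//=; last first.
  by rewrite -{2}(size_random_word N omega) mem_words.
rewrite indicE mem_set// mulr1 big1 ?addr0// => w wN.
rewrite indicE memNset ?mulr0//= => /eqP; rewrite eq_sym.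
by rewrite (negbTE wN).
Qed.

Lemma measurable_fun_random_word N (F : seq bool -> R) :
  measurable_fun setT (fun omega : Omega => F (random_word N omega)).
Proof.
under eq_fun do rewrite random_wordE.
apply: measurable_sum => w; apply: measurable_funM; first exact: measurable_cst.
by apply: measurable_indic; exact: measurable_random_word.
Qed.

Lemma integral_random_word N (F : seq bool -> R) :
  (\int[P]_omega (F (random_word N omega))%:E =
   (\sum_(w <- words N) m w * F w)%:E)%E.
Proof.
under eq_integral do rewrite random_wordE -sumEFin.
have iw w : P.-integrable setT
    (fun omega => (\1_(random_word N @^-1` [set w]) omega)%:E).
  by apply: integrable_indic; exact: measurable_random_word.
rewrite integral_sum//=; last first.
  by move=> w; under eq_fun do rewrite EFinM; exact: integrableZl.
rewrite -sumEFin big_seq [RHS]big_seq; apply: eq_bigr => w /size_words wN.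
under eq_integral do rewrite EFinM.
rewrite integralZl// integral_indic//; last exact: measurable_random_word.
rewrite setIT mulrC EFinM; congr (_ * _)%E; exact: probability_random_word.
Qed.

End random_words.

Lemma bounded_integrable d (T : measurableType d) (R : realType)
    (mu : {finite_measure set T -> \bar R}) (f : T -> R) (c : R) :
  measurable_fun setT f -> (forall x, `|f x| <= c) ->
  mu.-integrable setT (EFin \o f).
Proof.
move=> mf fc; apply: measurable_bounded_integrable => //.
  exact: fin_num_fun_lty.
exists c; split; first exact: num_real.
by move=> x cx y _ /=; rewrite (le_trans (fc y))// ltW.
Qed.

(** * Almost everywhere convergence from square bounds *)

Section L2_cauchy.
Context d (T : measurableType d) (R : realType) (P : probability T R).
Variable h : nat -> T -> R.
Hypothesis mh : forall N, measurable_fun setT (h N).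

(* AM-GM turns the quadratic bound into a summable bound on the first moments
   of the increments, so the telescoping series converges absolutely. *)
Lemma ae_cvg_of_L2 :
  (forall k, \int[P]_x ((h k.+1 x - h k x) ^+ 2)%:E <= ((4%:R ^- k) : R)%:E)%E ->
  {ae P, forall x, cvgn (h ^~ x)}.
Proof.
have PT : P setT = 1%E := probability_setT P.
move=> hL2; pose D k x := `|h k.+1 x - h k x|.
have mD k : measurable_fun setT (D k).
  by apply: measurableT_comp => //; exact: measurable_funB.
have D0 k x : (0 <= (D k x)%:E)%E by rewrite lee_fin normr_ge0.
have D1 k : (\int[P]_x (D k x)%:E <= ((2%:R ^- k) : R)%:E)%E.
  (* The weight 2^k balances the two terms: D <= (2^k D^2 + 2^-k) / 2 has integral at most (2^k 4^-k
     + 2^-k) / 2 = 2^-k. *)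
  pose u k : R := 2%:R ^+ k.
  have u0 : 0 < u k by rewrite exprn_gt0.
  have le_u x : D k x <= 2^-1 * (u k * (h k.+1 x - h k x) ^+ 2) + 2^-1 * (u k)^-1.
    rewrite -subr_ge0 -[(h k.+1 x - h k x) ^+ 2]real_normK ?num_real// -/(D k x).
    have -> : 2^-1 * (u k * D k x ^+ 2) + 2^-1 * (u k)^-1 - D k x =
      2^-1 * (u k)^-1 * (u k * D k x - 1) ^+ 2 by field; rewrite gt_eqF.
    by rewrite mulr_ge0 ?sqr_ge0// mulr_ge0 ?invr_ge0// ltW.
  have mh2 : measurable_fun setT (fun x => (h k.+1 x - h k x) ^+ 2).
    by apply: measurable_funX; exact: measurable_funB.
  apply: (@le_trans _ _ (\int[P]_x ((2^-1 * u k)%:E *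
      ((h k.+1 x - h k x) ^+ 2)%:E + (2^-1 * (u k)^-1)%:E))%E).
    apply: ge0_le_integral => //.
    - exact/measurable_EFinP.
    - by apply: emeasurable_funD => //; apply: measurable_funeM; exact/measurable_EFinP.
    - by move=> x _; rewrite -EFinM -EFinD lee_fin -mulrA.
  have uu : 0 <= 2^-1 * u k by rewrite mulr_ge0// ltW.
  rewrite ge0_integralD//; last 3 first.
  - by move=> x _; rewrite -EFinM lee_fin mulr_ge0// sqr_ge0.
  - by apply: measurable_funeM; exact/measurable_EFinP.
  - by move=> x _; rewrite lee_fin mulr_ge0// invr_ge0 ltW.
  rewrite ge0_integralZl//; last 2 first.
  - exact/measurable_EFinP.
  - by move=> x _; rewrite lee_fin sqr_ge0.
  rewrite integral_cst// [X in (_ + _ * X)%E](_ : _ = 1%E); last exact: PT.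
  rewrite mule1.
  apply: (@le_trans _ _ ((2^-1 * u k)%:E * (4%:R ^- k)%:E + (2^-1 * (u k)^-1)%:E)%E).
    by apply: leeD => //; apply: lee_wpmul2l; rewrite ?lee_fin.
  rewrite -EFinM -EFinD lee_fin /u.
  rewrite (_ : 4%:R = 2%:R * 2%:R :> R); last by rewrite -natrM.
  rewrite exprMn invfM -/(u k).
  by rewrite le_eqVlt; apply/orP; left; apply/eqP; field; rewrite gt_eqF.
have intD : P.-integrable setT (fun x => \sum_(k <oo) (D k x)%:E)%E.
  apply/integrableP; split.
    by apply: ge0_emeasurable_sum => // k _; apply/measurable_EFinP.
  under eq_integral.
    move=> x _; rewrite gee0_abs; last by apply: nneseries_ge0.
    over.
  rewrite integral_nneseries//; last by move=> k; exact/measurable_EFinP.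
  apply: (@le_lt_trans _ _ (\sum_(k <oo) ((2%:R ^- k) : R)%:E)%E).
    by apply: lee_nneseries => // k _ _; exact: integral_ge0.
  have half0 (k : nat) : 0 <= 2%:R ^- k :> R by rewrite invr_ge0 exprn_ge0.
  have -> : (\sum_(k <oo) ((2%:R ^- k) : R)%:E = (2 : R)%:E)%E; last exact: ltry.
  apply/cvg_lim => //; apply: cvg_EFin.
    by apply: nearW => N; rewrite sumEFin.
  rewrite [X in X @ _ --> _](_ : _ = series (fun k => 2 / (2 ^ (k + 1))%:R : R)).
    by have := @cvg_geometric_series_half R 2 0; rewrite expr0 divr1; apply.
  apply/funext => N /=; rewrite /series /= sumEFin /=; apply: eq_bigr => k _.
  by rewrite addn1 natrX exprS invfM mulrA divff ?mul1r.
have := integrable_ae measurableT intD.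
apply: filterS => x /(_ I) hx.
have cD : cvgn (series (D ^~ x)).
  apply: nondecreasing_is_cvgn.
    by apply: nondecreasing_series => k *; exact: normr_ge0.
  exists (fine (\sum_(k <oo) (D k x)%:E)%E) => _ [n _ <-].
  rewrite -lee_fin fineK// -sumEFin.
  exact: nneseries_lim_ge.
have cd : cvgn (series (fun k => h k.+1 x - h k x)) by apply: normed_cvg.
rewrite (_ : h ^~ x = fun n => h 0%N x + series (fun k => h k.+1 x - h k x) n).
  by apply: is_cvgD => //; exact: is_cvg_cst.
apply/funext => n; rewrite /series /=.
by rewrite (telescope_sumr (fun k => h k x))// addrC subrK.
Qed.

End L2_cauchy.

(** * Evaluation and Borel measurability *)

Section evaluation.
Variables (R : realType) (n r : nat).
Local Notation Rx := (mpoly.mpoly n R).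
Local Notation Vr := (Vr R n r).

(** Constants and variables generate R[x] as a ring. This induction serves for convergence,
    measurability and approximability, all stable under sums and products. *)
Lemma mpoly_subring_ind (Q : Rx -> Prop) :
  (forall c, Q (mpoly.mpolyC n c)) ->
  (forall i, Q (mpoly.mpolyX R (mpoly.mnm1 i))) ->
  (forall p q, Q p -> Q q -> Q (p + q)) ->
  (forall p q, Q p -> Q q -> Q (p * q)) -> forall p, Q p.
Proof.
move=> QC QX QD QM p; elim/mpoly.mpolyind: p => [|c a p _ _ Qp].
  by rewrite -mpoly.mpolyC0; exact: QC.
apply: QD => //; rewrite -mpoly.mul_mpolyC mpoly.mpolyXE_id.
apply: (QM) => //; apply: (big_ind Q); [by rewrite -mpoly.mpolyC1|exact: QM|].
move=> i _; move: (a i) => k; elim: k => [|k IH]; last by rewrite exprS; exact: QM.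
by rewrite expr0 -mpoly.mpolyC1; exact: QC.
Qed.

Lemma evalxD (x : 'rV[R]_n) (p q : Rx) : evalx (p + q) x = evalx p x + evalx q x.
Proof. exact: mpoly.mevalD. Qed.

Lemma evalxM (x : 'rV[R]_n) (p q : Rx) : evalx (p * q) x = evalx p x * evalx q x.
Proof. exact: mpoly.mevalM. Qed.

Lemma evalxC (x : 'rV[R]_n) c : evalx (mpoly.mpolyC n c) x = c.
Proof. exact: mpoly.mevalC. Qed.

Lemma evalxX (x : 'rV[R]_n) a : evalx (mpoly.mpolyX R a) x = monx a x.
Proof. exact: mpoly.mevalX. Qed.

Lemma evalxXU (x : 'rV[R]_n) i : evalx (mpoly.mpolyX R (mpoly.mnm1 i)) x = x 0 i.
Proof. exact: mpoly.mevalXU. Qed.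

Lemma evalx0 (x : 'rV[R]_n) : evalx 0 x = 0.
Proof. exact: mpoly.meval0. Qed.

Lemma evalx_sum (x : 'rV[R]_n) I (s : seq I) (F : I -> Rx) :
  evalx (\sum_(i <- s) F i) x = \sum_(i <- s) evalx (F i) x.
Proof. by rewrite (big_morph (fun p => evalx p x) (evalxD x) (evalx0 x)). Qed.

Lemma evalVD (u : 'rV[R]_n * 'rV[R]_r) (p q : Vr) :
  evalV (p + q) u = evalV p u + evalV q u.
Proof.
rewrite /evalV /= evalxD addrACA -big_split /=; congr (_ + _).
by apply: eq_bigr => k _; rewrite mxE evalxD mulrDr.
Qed.

Lemma evalVZ (u : 'rV[R]_n * 'rV[R]_r) (p : Rx) (v : Vr) :
  evalV (p *: v) u = evalx p u.1 * evalV v u.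
Proof.
rewrite /evalV /= evalxM mulrDr; congr (_ + _); rewrite mulr_sumr.
by apply: eq_bigr => k _; rewrite mxE evalxM mulrCA.
Qed.

Lemma evalV_in_Vr (u : 'rV[R]_n * 'rV[R]_r) p : evalV (in_Vr r p) u = evalx p u.1.
Proof.
by rewrite /evalV /= big1 ?addr0// => k _; rewrite mxE evalx0 mulr0.
Qed.

Lemma evalV_lam (u : 'rV[R]_n * 'rV[R]_r) k : evalV (lam R n k) u = u.2 0 k.
Proof.
rewrite /evalV /= evalx0 add0r (bigD1 k)//= big1 ?addr0.
  by rewrite mxE !eqxx -mpoly.mpolyC1 evalxC mulr1.
by move=> j jk; rewrite mxE eqxx /= (negbTE jk) evalx0 mulr0.
Qed.

Lemma evalV0 (u : 'rV[R]_n * 'rV[R]_r) : evalV (0 : Vr) u = 0.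
Proof. by have := evalV_in_Vr u 0; rewrite evalx0. Qed.

Lemma evalVB (u : 'rV[R]_n * 'rV[R]_r) (p q : Vr) :
  evalV (p - q) u = evalV p u - evalV q u.
Proof. by apply: (addIr (evalV q u)); rewrite -evalVD !subrK. Qed.

Lemma evalV_sum (u : 'rV[R]_n * 'rV[R]_r) I (s : seq I) (F : I -> Vr) :
  evalV (\sum_(i <- s) F i) u = \sum_(i <- s) evalV (F i) u.
Proof. by rewrite (big_morph (fun p => evalV p u) (evalVD u) (evalV0 u)). Qed.

Lemma VrE (p : Vr) :
  p = in_Vr r p.1 + \sum_(k < r) (p.2 0 k) *: lam R n k.
Proof.
case: p => p0 p1 /=; rewrite /in_Vr /lam.
have -> : \sum_(k < r) p1 0 k *: ((0, delta_mx 0 k) : Vr) =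
    (0, \sum_(k < r) p1 0 k *: delta_mx 0 k).
  apply: (big_ind2 (fun (x : Vr) y => x = (0, y))) => //.
    by move=> x y x' y' -> ->; congr pair; rewrite /= addr0.
  by move=> k _; congr pair; rewrite /= scaler0.
by rewrite -row_sum_delta; congr pair; rewrite /= ?addr0 ?add0r.
Qed.

Lemma sos_evalx_ge0 (x : 'rV[R]_n) p : sos p -> 0 <= evalx p x.
Proof.
move=> [qs ->]; rewrite evalx_sum; apply: sumr_ge0 => q _.
by rewrite expr2 evalxM -expr2 sqr_ge0.
Qed.

Lemma quadratic_module_evalV_ge0 m (g : 'I_m -> Vr) p u :
  quadratic_module g p -> feasible_set g u -> 0 <= evalV p u.
Proof.
move=> [s0 [s [h0 hs ->]]] gu.
rewrite evalVD evalV_in_Vr addr_ge0 ?sos_evalx_ge0// evalV_sum.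
by apply: sumr_ge0 => i _; rewrite evalVZ mulr_ge0 ?sos_evalx_ge0//; exact: gu.
Qed.

Lemma cvg_evalx (x : nat -> 'rV[R]_n) (l : 'rV[R]_n) p :
  (forall i, (fun k => x k 0 i) @ \oo --> l 0 i) ->
  (fun k => evalx p (x k)) @ \oo --> evalx p l.
Proof.
move=> hx; elim/mpoly_subring_ind: p => [c|i|p q hp hq|p q hp hq].
- by under eq_fun do rewrite evalxC; rewrite evalxC; exact: cvg_cst.
- by under eq_fun do rewrite evalxXU; rewrite evalxXU; exact: hx.
- by under eq_fun do rewrite evalxD; rewrite evalxD; exact: cvgD.
- by under eq_fun do rewrite evalxM; rewrite evalxM; exact: cvgM.
Qed.

Lemma cvg_evalV (u : nat -> 'rV[R]_n * 'rV[R]_r) (l : 'rV[R]_n * 'rV[R]_r) (p : Vr) :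
  (forall i, (fun k => (u k).1 0 i) @ \oo --> l.1 0 i) ->
  (forall i, (fun k => (u k).2 0 i) @ \oo --> l.2 0 i) ->
  (fun k => evalV p (u k)) @ \oo --> evalV p l.
Proof.
move=> h1 h2; apply: cvgD; first exact: (@cvg_evalx (fun k => (u k).1)).
apply: cvg_big => [|i _]; [exact: add_continuous|apply: cvgM => //].
exact: (@cvg_evalx (fun k => (u k).1)).
Qed.

Lemma measurable_evalx d (T : measurableType d) (x : T -> 'rV[R]_n) p :
  (forall i, measurable_fun setT (fun t => x t 0 i)) ->
  measurable_fun setT (fun t => evalx p (x t)).
Proof.
move=> hx; elim/mpoly_subring_ind: p => [c|i|p q hp hq|p q hp hq].
- by under eq_fun do rewrite evalxC; exact: measurable_cst.
- by under eq_fun do rewrite evalxXU; exact: hx.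
- by under eq_fun do rewrite evalxD; exact: measurable_funD.
- by under eq_fun do rewrite evalxM; exact: measurable_funM.
Qed.

Lemma measurable_evalV d (T : measurableType d) (x : T -> 'rV[R]_n * 'rV[R]_r)
    (p : Vr) :
  (forall i, measurable_fun setT (fun t => (x t).1 0 i)) ->
  (forall i, measurable_fun setT (fun t => (x t).2 0 i)) ->
  measurable_fun setT (fun t => evalV p (x t)).
Proof.
move=> h1 h2; apply: measurable_funD.
  exact: (@measurable_evalx _ _ (fun t => (x t).1)).
apply: measurable_sum => i; apply: measurable_funM => //.
exact: (@measurable_evalx _ _ (fun t => (x t).1)).
Qed.

End evaluation.

(** * Borel measurability through coordinates *)

Section borel.
Variable R : realType.

Lemma measurable_of_open_preimage (T : pointedType) (G : set_system T) (f : T -> R) :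
  (forall U, open U -> G (f @^-1` U)) ->
  measurable_fun (setT : set (g_sigma_algebraType G)) f.
Proof.
move=> Gf; apply: (measurability _ (RGenOpens.measurableE R)).
move=> _ [_ [a [b ->] <-]]; rewrite setTI; apply: sub_sigma_algebra.
by apply: Gf; exact: interval_open.
Qed.

Variables (n r : nat).
Local Notation Vec := ('rV[R]_n * 'rV[R]_r)%type.

(** Boxes with rational centre and radius 1 / (k + 1): a countable base of the topology. *)
Definition rational_box (c : 'rV[rat]_n * 'rV[rat]_r * nat) : set Vec :=
  [set u : Vec | (forall i, `|ratr (c.1.1 0 i) - u.1 0 i| < c.2.+1%:R^-1) /\
           (forall i, `|ratr (c.1.2 0 i) - u.2 0 i| < c.2.+1%:R^-1)].

Lemma ratr_approx N (x : 'rV[R]_N) (e : R) : 0 < e ->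
  exists q : 'rV[rat]_N, forall i, `|ratr (q 0 i) - x 0 i| < e.
Proof.
move=> e0; have h i : exists q : rat, `|ratr q - x 0 i| < e.
  have /rat_in_itvoo[q] : x 0 i - e < x 0 i + e by lra.
  by rewrite in_itv /= => hq; exists q; rewrite ltr_norml; lra.
have [q hq] := choice h.
by exists (\row_i q i) => i; rewrite mxE.
Qed.

(** Boxes not contained in [U] are replaced by the empty set, so that the union runs over a fixed
    countable type. *)
Lemma open_rational_boxes (U : set Vec) : open U ->
  U = \bigcup_c (if `[< rational_box c `<=` U >] then rational_box c else set0).
Proof.
move=> oU; apply/seteqP; split; last first.
  by move=> u [c _]; case: asboolP => // cU; exact: cU.
move=> u Uu; have : nbhs u U by exact: open_nbhs_nbhs.
move=> /nbhs_ballP[e /= e0 eU].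
(* A box of radius less than e / 2 that contains [u] stays within the ball of radius e about [u]. *)
have [k hk] : exists k, (k.+1%:R^-1 : R) < e / 2.
  have e2 : 0 < e / 2 by apply: divr_gt0.
  exists (Num.trunc (e / 2)^-1).
  rewrite -[ltRHS]invrK ltf_pV2 ?posrE ?invr_gt0//.
  exact: truncnS_gt.
have k0 : 0 < k.+1%:R^-1 :> R by rewrite invr_gt0.
have [q1 h1] := ratr_approx u.1 k0.
have [q2 h2] := ratr_approx u.2 k0.
exists (q1, q2, k) => //; case: asboolP => [_|[]]; first by split.
move=> v [/= v1 v2]; apply: eU; split; split => // i j; rewrite !ord1.
- have := v1 j; have := h1 j; move: hk; set d := k.+1%:R^-1.
  by rewrite /ball /= !ltr_norml => ? ? ?; lra.
- have := v2 j; have := h2 j; move: hk; set d := k.+1%:R^-1.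
  by rewrite /ball /= !ltr_norml => ? ? ?; lra.
Qed.

(** The preimage of an open set is a countable union of preimages of boxes, and each of these is a
    finite intersection of conditions on single coordinates. *)
Lemma measurable_to_borel d (T : measurableType d) (f : T -> Vec) :
  (forall i, measurable_fun setT (fun t => (f t).1 0 i)) ->
  (forall i, measurable_fun setT (fun t => (f t).2 0 i)) ->
  measurable_fun setT (f : T -> borel Vec).
Proof.
move=> h1 h2; apply: (@measurability _ _ T (borel Vec) _ _ (@open Vec)) => //.
move=> _ [U oU <-]; rewrite setTI (open_rational_boxes oU) preimage_bigcup.
apply: countable_bigcupT_measurable => [|c]; first exact: countableP.
case: asboolP => _; last first.
  by rewrite preimage_set0.
have mlt (q : rat) (e : R) (h : T -> R) : measurable_fun setT h ->
    measurable [set t | `|ratr q - h t| < e].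
  move=> mh; rewrite -[X in measurable X]setTI.
  have : measurable_fun setT (fun t => `|ratr q - h t|).
    by apply: measurableT_comp => //; apply: measurable_funB.
  move=> /(_ measurableT `]-oo, e[%classic (measurable_itv _)).
  by congr (measurable _); apply/seteqP; split => t /=; rewrite in_itv.
rewrite (_ : _ @^-1` _ =
  (\bigcap_(i in [set: 'I_n])
     [set t | `|ratr (c.1.1 0 i) - (f t).1 0 i| < c.2.+1%:R^-1]) `&`
  (\bigcap_(i in [set: 'I_r])
     [set t | `|ratr (c.1.2 0 i) - (f t).2 0 i| < c.2.+1%:R^-1])); last first.
  apply/seteqP; split => t /=; move=> [a b]; split => i.
  - by move=> _; exact: a.
  - by move=> _; exact: b.
  - exact: a.
  - exact: b.
by apply: measurableI; apply: fin_bigcap_measurable => [|i _];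
  [exact: finite_finset|exact: mlt|exact: finite_finset|exact: mlt].
Qed.

End borel.

(** * The functional L_(y,z) *)

Section pairing.
Variables (R : realType) (n : nat).
Local Notation Rx := (mpoly.mpoly n R).
Local Notation mon := (mpoly.multinom n).
Implicit Types (y : mon -> R) (p q : Rx).

(** Coefficients outside the support vanish; polynomials with different supports can thus be summed
    over one common list. *)
Lemma pairing_widen (s : seq mon) p y : uniq s -> {subset mpoly.msupp p <= s} ->
  pairing p y = \sum_(a <- s) mpoly.mcoeff a p * y a.
Proof.
move=> us sub; rewrite /pairing.
rewrite [RHS](bigID (fun a => a \in mpoly.msupp p)) /= [X in _ + X]big1 ?addr0.
  rewrite -[RHS]big_filter; apply: perm_big.
  apply: uniq_perm; rewrite ?filter_uniq ?mpoly.msupp_uniq// => a.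
  by rewrite mem_filter andb_idr// => /sub.
by move=> a /mpoly.memN_msupp_eq0 ->; rewrite mul0r.
Qed.

Lemma pairingD p q y : pairing (p + q) y = pairing p y + pairing q y.
Proof.
pose s := undup (mpoly.msupp p ++ mpoly.msupp q ++ mpoly.msupp (p + q)).
have us : uniq s by exact: undup_uniq.
rewrite !(@pairing_widen s)//; first by
  rewrite -big_split /=; apply: eq_bigr => a _; rewrite mpoly.mcoeffD mulrDl.
all: by move=> a ha; rewrite mem_undup !mem_cat ha ?orbT.
Qed.

Lemma pairingZ c p y : pairing (c *: p) y = c * pairing p y.
Proof.
pose s := undup (mpoly.msupp p ++ mpoly.msupp (c *: p)).
have us : uniq s by exact: undup_uniq.
rewrite !(@pairing_widen s)//; first by
  rewrite mulr_sumr; apply: eq_bigr => a _; rewrite mpoly.mcoeffZ mulrA.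
all: by move=> a ha; rewrite mem_undup !mem_cat ha ?orbT.
Qed.

Lemma pairing0 y : pairing 0 y = 0.
Proof. by rewrite -(scale0r (0 : Rx)) pairingZ mul0r. Qed.

Lemma pairingX a y : pairing (mpoly.mpolyX R a) y = y a.
Proof. by rewrite /pairing mpoly.msuppX big_seq1 mpoly.mcoeffX eqxx mul1r. Qed.

Lemma pairing1 y : pairing 1 y = y mpoly.mnm0.
Proof. by rewrite -mpoly.mpolyX0 pairingX. Qed.

(** Multiplication by a monomial becomes a shift of the sequence, which turns localizing matrices
    into values of the functional. *)
Lemma pairing_shift a p y :
  pairing (mpoly.mpolyX R a * p) y = pairing p (fun c => y (mpoly.mnm_add a c)).
Proof.
elim/mpoly.mpolyind: p => [|c b p _ _ IH]; first by rewrite mulr0 !pairing0.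
rewrite mulrDr !pairingD IH; congr (_ + _).
by rewrite -scalerAr !pairingZ -mpoly.mpolyXD !pairingX.
Qed.

End pairing.

Section Lyz.
Variables (R : realType) (n r : nat).
Local Notation Rx := (mpoly.mpoly n R).
Local Notation mon := (mpoly.multinom n).
Local Notation Vr := (Vr R n r).
Variables (y : mon -> R) (z : 'I_r -> mon -> R).

Lemma LyzD (p q : Vr) : Lyz y z (p + q) = Lyz y z p + Lyz y z q.
Proof.
rewrite /Lyz /= pairingD addrACA -big_split /=; congr (_ + _).
by apply: eq_bigr => k _; rewrite mxE pairingD.
Qed.

Lemma Lyz_nmod : nmod_morphism (Lyz y z : Vr -> R).
Proof.
split; last exact: LyzD.
by rewrite /Lyz pairing0 big1 ?addr0// => k _; rewrite mxE pairing0.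
Qed.

HB.instance Definition _ := GRing.isNmodMorphism.Build Vr R (Lyz y z) Lyz_nmod.

Definition Lyz_additive : {additive Vr -> R} := Lyz y z.

Lemma LyzZ (c : R) (p : Vr) : Lyz y z (c%:A *: p) = c * Lyz y z p.
Proof.
rewrite /Lyz /= [c%:A *: _]mulr_algl pairingZ mulrDr; congr (_ + _).
by rewrite mulr_sumr; apply: eq_bigr => k _; rewrite mxE mulr_algl pairingZ.
Qed.

Lemma LyzZl (c : R) (p : Rx) (u : Vr) :
  Lyz y z ((c *: p) *: u) = c * Lyz y z (p *: u).
Proof. by rewrite -LyzZ scalerA mulr_algl. Qed.

Lemma in_VrE (p : Rx) : in_Vr r p = p *: in_Vr r 1 :> Vr.
Proof. by congr pair; rewrite /= ?scaler0//; exact: esym (mulr1 _). Qed.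

Lemma cstVE c : cstV n r c = c%:A *: in_Vr r 1 :> Vr.
Proof. by rewrite /cstV in_VrE mpoly.alg_mpolyC. Qed.

Lemma Lyz_in_Vr p : Lyz y z (in_Vr r p) = pairing p y.
Proof. by rewrite /Lyz big1 ?addr0// => k _; rewrite mxE pairing0. Qed.

Lemma Lyz_lam p k : Lyz y z (p *: lam R n k) = pairing p (z k).
Proof.
rewrite /Lyz /= [X in pairing X y]mulr0 pairing0 add0r (bigD1 k)//= big1 ?addr0.
  by rewrite !mxE !eqxx mulr1.
by move=> j jk; rewrite !mxE eqxx /= (negbTE jk) mulr0 pairing0.
Qed.

Lemma moment_matrixE a b : moment_matrix y a b =
  Lyz y z ((mpoly.mpolyX R a * mpoly.mpolyX R b) *: in_Vr r 1).
Proof. by rewrite -in_VrE Lyz_in_Vr -mpoly.mpolyXD pairingX. Qed.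

Lemma localizing_matrixE (u : Vr) a b : localizing_matrix u y z a b =
  Lyz y z ((mpoly.mpolyX R a * mpoly.mpolyX R b) *: u).
Proof.
rewrite /Lyz /localizing_matrix -mpoly.mpolyXD /=; congr (_ + _).
  by rewrite -pairing_shift.
by apply: eq_bigr => k _; rewrite -pairing_shift mxE.
Qed.

(** The quadratic form of [M] at the coefficient vector of q is L (q^2 u), and finitely supported
    vectors are exactly the coefficient vectors of polynomials. *)
Lemma psd_infinite_sq_positive (M : mon -> mon -> R) (u : Vr) :
  (forall a b, M a b = Lyz y z ((mpoly.mpolyX R a * mpoly.mpolyX R b) *: u)) ->
  psd_infinite M <-> sq_positive (Lyz y z) u.
Proof.
move=> ME.
have quad N (s : 'I_N -> mon) (v : 'cV[R]_N) :
    (v^T *m (\matrix_(i, j) M (s i) (s j)) *m v) 0 0 =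
    Lyz y z ((\sum_i v i 0 *: mpoly.mpolyX R (s i)) ^+ 2 *: u).
  rewrite expr2 mulr_suml scaler_suml raddf_sum /= mxE.
  under [LHS]eq_bigr do rewrite mxE mulr_suml.
  rewrite exchange_big; apply: eq_bigr => i _ /=.
  rewrite mulr_sumr scaler_suml raddf_sum /=; apply: eq_bigr => j _.
  have scale2 (c d : R) (p q : Rx) : (c *: p) * (d *: q) = (c * d) *: (p * q).
    by rewrite -scalerAl -scalerAr scalerA.
  by rewrite scale2 LyzZl -ME mxE mxE mulrAC.
split=> [Mpsd q|upos N s sinj].
  (* The finite submatrix to be tested is the one indexed by the support of [q]. *)
  pose s (i : 'I_(size (mpoly.msupp q))) := nth mpoly.mnm0 (mpoly.msupp q) i.
  have sinj : injective s.
    move=> i j /eqP; rewrite nth_uniq ?mpoly.msupp_uniq//.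
    by move=> /eqP ij; exact: val_inj.
  have [_ /(_ (\col_i mpoly.mcoeff (s i) q))] := Mpsd _ s sinj.
  rewrite quad.
  have <- // : q = \sum_i (\col_i mpoly.mcoeff (s i) q) i 0 *: mpoly.mpolyX R (s i).
  rewrite [LHS]mpoly.mpolyE (big_nth mpoly.mnm0) big_mkord.
  by apply: eq_bigr => i _; rewrite mxE.
split; last by move=> v; rewrite quad; exact: upos.
by apply/matrixP => i j; rewrite !mxE !ME mulrC.
Qed.

(** The module is spanned additively by the elements q^2 and q^2 g_i, so nonnegativity need only be
    tested on these. *)
Lemma quadratic_module_nonnegP m (g : 'I_m -> Vr) :
  (forall p, quadratic_module g p -> 0 <= Lyz y z p) <->
  sq_positive (Lyz y z) (in_Vr r 1) /\ forall i, sq_positive (Lyz y z) (g i).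
Proof.
have sos0 : sos (0 : Rx) by exists [::]; rewrite big_nil.
have sosq q : sos (q ^+ 2 : Rx) by exists [:: q]; rewrite big_seq1.
split=> [pos|[e_pos g_pos] p].
  split=> [q|i q]; apply: pos.
    exists (q ^+ 2), (fun=> 0); split => //.
    by rewrite big1 => [|i _]; rewrite ?scale0r// addr0 -in_VrE.
  exists 0, (fun j => if j == i then q ^+ 2 else 0); split => // [j|].
    by case: eqP.
  rewrite (bigD1 i)//= eqxx big1 => [|j /negbTE ->]; last by rewrite scale0r.
  by rewrite addr0 in_VrE scale0r add0r.
have pos_sos s u : sos s -> sq_positive (Lyz y z) u -> 0 <= Lyz y z (s *: u).
  move=> [qs ->] upos; rewrite scaler_suml raddf_sum /=.
  by apply: sumr_ge0 => q _; exact: upos.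
move=> [s0 [s [h0 hs ->]]]; rewrite raddfD raddf_sum /= in_VrE addr_ge0 ?pos_sos//.
by apply: sumr_ge0 => i _; exact: pos_sos.
Qed.

(** The quadratic module is stable under multiplication by q^2. *)
Lemma quadratic_module_sq_positive m (g : 'I_m -> Vr) p :
  (forall p, quadratic_module g p -> 0 <= Lyz y z p) ->
  quadratic_module g p -> sq_positive (Lyz y z) p.
Proof.
move=> pos [s0 [s [[q0 h0] hs ->]]] q; apply: pos.
exists (q ^+ 2 * s0), (fun i => q ^+ 2 * s i); split.
- exists [seq q * t | t <- q0]; rewrite h0 big_map mulr_sumr.
  by apply: eq_bigr => t _; rewrite exprMn.
- move=> i; have [qi ->] := hs i.
  exists [seq q * t | t <- qi]; rewrite big_map mulr_sumr.
  by apply: eq_bigr => t _; rewrite exprMn.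
- rewrite scalerDr scaler_sumr; congr (_ + _); last first.
    by apply: eq_bigr => i _; rewrite scalerA.
  by rewrite [RHS]in_VrE [in_Vr r s0]in_VrE scalerA.
Qed.

End Lyz.

(** * From random points to representing measures *)

Section feasible.
Variables (R : realType) (n r m : nat).
Local Notation Vec := ('rV[R]_n * 'rV[R]_r)%type.
Variable g : 'I_m -> Vr R n r.

Lemma measurable_coord1 i : measurable_fun (setT : set (borel Vec)) (fun u => u.1 0 i).
Proof.
apply: measurable_of_open_preimage; apply/continuousP => u.
exact: (@continuous_comp Vec 'rV[R]_n R fst (fun x => x 0 i) u cvg_fst
  (@coord_continuous _ _ _ _ _ _)).
Qed.

Lemma measurable_coord2 i : measurable_fun (setT : set (borel Vec)) (fun u => u.2 0 i).
Proof.
apply: measurable_of_open_preimage; apply/continuousP => u.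
exact: (@continuous_comp Vec 'rV[R]_r R snd (fun x => x 0 i) u cvg_snd
  (@coord_continuous _ _ _ _ _ _)).
Qed.

Lemma measurable_feasible_set : measurable (feasible_set g : set (borel Vec)).
Proof.
rewrite (_ : feasible_set g = \bigcap_(i in setT) [set u | 0 <= evalV (g i) u]).
  apply: fin_bigcap_measurable => [|i _]; first exact: finite_finset.
  have := @measurable_evalV R n r _ (borel Vec) id (g i)
    measurable_coord1 measurable_coord2.
  move=> /(_ measurableT `[0, +oo[%classic (measurable_itv _)).
  by rewrite setTI; congr measurable; apply/seteqP; split => u /=;
    rewrite in_itv /= andbT.
by apply/seteqP; split => u /= h; [move=> i _|move=> i]; exact: h.
Qed.

Lemma measurable_monx a : measurable_fun (setT : set (borel Vec)) (fun u => monx a u.1).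
Proof.
under eq_fun do rewrite -evalxX.
by apply: (@measurable_evalx R n _ (borel Vec) fst) => i; exact: measurable_coord1.
Qed.

Variables (y : mpoly.multinom n -> R) (z : 'I_r -> mpoly.multinom n -> R).

Lemma has_integral_pushforward d (T : measurableType d) (P : probability T R)
    (X : {mfun T >-> borel Vec}) (f : borel Vec -> R) v :
  measurable_fun setT f ->
  distribution P X (~` feasible_set g) = 0%E ->
  has_integral P setT (f \o X) v ->
  has_integral (distribution P X) (feasible_set g) f v.
Proof.
move=> mf K0 [intf If].
have mK := measurable_feasible_set.
have mEf : measurable_fun setT (EFin \o f) by exact/measurable_EFinP.
have intD : (distribution P X).-integrable setT (EFin \o f).
  by apply: integrable_pushforward => //; exact: measurable_funPT.
split; first exact: integrableS intD.
rewrite -[RHS]If -[in LHS](setCK (feasible_set g)) -(setTD (~` _)).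
rewrite -negligible_integral//; last exact: measurableC.
by rewrite integral_pushforward//; exact: measurable_funPT.
Qed.

(** Serves twice: for the random limit point that proves (ii) => (i), and for the graph of tau. *)
Lemma representing_pushforward d (T : measurableType d) (P : probability T R)
    (X : T -> Vec) :
  (forall i, measurable_fun setT (fun t => (X t).1 0 i)) ->
  (forall i, measurable_fun setT (fun t => (X t).2 0 i)) ->
  {ae P, forall t, feasible_set g (X t)} ->
  (forall a, has_integral P setT (fun t => monx a (X t).1) (y a)) ->
  (forall k a, has_integral P setT (fun t => monx a (X t).1 * (X t).2 0 k) (z k a)) ->
  exists2 rho : probability (borel Vec) R,
    forall A, measurable A -> rho A = pushforward P (X : T -> borel Vec) A
    & representing_measure g y z rho.
Proof.
move=> m1 m2 aeK hy hz.
pose X' : {mfun T >-> borel Vec} :=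
  HB.pack (X : T -> borel Vec) (isMeasurableFun.Build _ _ _ _ _ (measurable_to_borel m1 m2)).
have K0 : distribution P X' (~` feasible_set g) = 0%E.
  have mK := measurable_feasible_set.
  have [N [mN N0 hN]] := aeK.
  apply: (subset_measure0 _ mN _ N0) => //.
  rewrite -[X in measurable X]setTI; apply: measurable_funPT => //.
  exact: measurableC.
exists (distribution P X') => //; split => //.
  move=> a; apply: has_integral_pushforward => //; first exact: measurable_monx.
  exact: hy.
move=> k a; apply: has_integral_pushforward => //; last exact: hz.
by apply: measurable_funM; [exact: measurable_monx|exact: measurable_coord2].
Qed.

End feasible.

(** * Convergence of the conditional means *)

(** Past some N k the sequence is within 4^-k of its limit. Adding up N 0, ..., N k and k gives an
    index that is monotone in k and at least both N k and k. *)
Lemma cvg_fast_subseq (R : realType) (u : nat -> R) :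
  nondecreasing_seq u -> cvgn u ->
  exists phi : nat -> nat, [/\ nondecreasing_seq phi, forall k, (k <= phi k)%N &
    forall k, u (phi k.+1) - u (phi k) <= 4%:R ^- k].
Proof.
move=> ndu cu.
have h k : exists N, forall M, (N <= M)%N -> limn u - u M <= 4%:R ^- k.
  have /cvgrPdist_le /(_ (4%:R ^- k)) := cu.
  rewrite invr_gt0 exprn_gt0// => /(_ isT)[N _ hN]; exists N => M NM.
  by apply: le_trans (hN M NM); exact: ler_norm.
have [N hN] := choice h.
pose phi k := (\sum_(j < k.+1) N j + k)%N.
exists phi; split => [|k|k].
- apply/nondecreasing_seqP => k; rewrite /phi leEnat [in leqRHS]big_ord_recr /=.
  by rewrite -addnA leq_add2l addnS ltnW// ltnS leq_addl.
- by rewrite /phi leq_addl.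
- apply: le_trans (hN k (phi k) _).
    by rewrite lerD2r; apply: nondecreasing_cvgn_le.
  by rewrite /phi big_ord_recr /= -addnA addnC -addnA leq_addr.
Qed.

(** The limit is replaced by 0 on a measurable null set containing all points of divergence, which
    keeps it measurable everywhere. *)
Lemma ae_limit d (T : measurableType d) (R : realType) (P : probability T R)
    (h : nat -> T -> R) :
  (forall k, measurable_fun setT (h k)) -> {ae P, forall t, cvgn (h ^~ t)} ->
  exists2 f : T -> R, measurable_fun setT f &
    {ae P, forall t, h ^~ t @ \oo --> f t}.
Proof.
move=> mh [N [mN N0 hN]].
pose G : set T := ~` N.
have mG : measurable G by exact: measurableC.
exists (fun t => if t \in G then limn (h ^~ t) else 0); last first.
  exists N; split => // t; apply: contra_notP => /= Nt; rewrite mem_set//.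
  by apply: contrapT => ht; apply: Nt; apply: hN.
apply: (@measurable_fun_cvg _ _ _ setT (fun k t => h k t * \1_G t)).
  by move=> k; apply: measurable_funM => //; exact: measurable_indic.
move=> t _; rewrite indicE; case: (boolP (t \in G)) => [|tG].
  rewrite inE => tG; under eq_fun do rewrite mulr1.
  by apply: contrapT => ht; apply: tG; apply: hN.
by under eq_fun do rewrite mulr0; exact: cvg_cst.
Qed.

Lemma modn_trials n (i : nat) (J : pred nat) : (i < n)%N ->
  (forall j, J j = (j %% n == i)%N) ->
  forall K, \forall N \near \oo, (K <= trials J N)%N.
Proof.
move=> lt_in JE; elim => [|K [N0 _ IH]]; first exact: nearW.
(* The index N0 n + i is at least N0 and has residue i, so it provides one more trial. *)
exists (N0 * n + i).+1 => // N /= hN.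
have /IH hK : (N0 <= N0 * n + i)%N.
  by rewrite (leq_trans _ (leq_addr _ _))// leq_pmulr// (leq_trans _ lt_in).
apply: (@leq_trans (trials J (N0 * n + i).+1)).
  by rewrite /trials big_ord_recr /= JE modnMDl modn_small// eqxx addn1 ltnS.
rewrite /trials -(subnKC hN) -!(big_mkord xpredT (fun j => nat_of_bool (J j))).
by rewrite [leqRHS](@big_cat_nat _ _ _ (N0 * n + i).+1)//= leq_addr.
Qed.

(** * Evaluation at the barycenters of the branches *)

Section construction.
Variables (R : realType) (n r m : nat) (g : 'I_m -> Vr R n r).
Hypothesis g_arch : restricted_archimedean g.
Variables (y : mpoly.multinom n -> R) (z : 'I_r -> mpoly.multinom n -> R).
Hypothesis y0 : y mpoly.mnm0 = 1.
Hypothesis L_ge0 : forall p, quadratic_module g p -> 0 <= Lyz y z p.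

Local Notation Rx := (mpoly.mpoly n R).
Local Notation Vr := (Vr R n r).
Local Notation L := (Lyz_additive y z).
Local Notation LZ := (LyzZ y z : forall c u, L (c%:A *: u) = c * L u).
Local Notation e := (in_Vr r (1 : Rx)).
Local Notation xv i := (mpoly.mpolyX R (mpoly.mnm1 i) : Rx).
Local Notation x_ i := (xv i *: e).
Local Notation l_ k := (lam R n k).

Lemma L_e_pos : sq_positive L e.
Proof. by have [/(_ L_ge0)[]] := quadratic_module_nonnegP y z g. Qed.

Lemma L_e1 : L e = 1.
Proof. by rewrite [LHS]Lyz_in_Vr pairing1. Qed.

Lemma L_arch u : exists N : R, [/\ 0 < N,
  sq_positive L (N%:A *: e + u) & sq_positive L (N%:A *: e - u)].
Proof.
have [N [N0 h1 h2]] := g_arch u; exists N; rewrite -cstVE; split => //.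
- exact: quadratic_module_sq_positive h1.
- exact: quadratic_module_sq_positive h2.
Qed.

Lemma ex_splitting : exists (f : nat -> Rx) (t : 'I_n -> Rx) (B : 'I_n -> R),
  [/\ forall j, sq_positive L (f j *: e), forall j, sq_positive L ((1 - f j) *: e),
      forall (i : 'I_n) j, (j %% n)%N == i -> f j = t i
    & forall i, xv i = (- B i)%:A + (2 * B i)%:A * t i].
Proof.
have [B hB] := choice (fun i => L_arch (x_ i)).
have B0 i : 0 < B i by case: (hB i).
pose t i : Rx := (2 * B i)^-1%:A * ((B i)%:A + xv i).
have tE i : xv i = (- B i)%:A + (2 * B i)%:A * t i.
  rewrite /t mulrA -!in_algE -rmorphM mulfV ?mulf_neq0 ?gt_eqF//.
  by rewrite rmorph1 rmorphN; ring.
(* For n = 0 the residue is not an index; the default factor 0 is harmless, as 0 and 1 are both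
   positive. *)
exists (fun j => if insub (j %% n)%N is Some i then t i else 0), t, B; split => //.
- move=> j; case: insubP => [i _ _|_]; last by move=> q; rewrite scale0r scaler0 raddf0.
  rewrite /t -scalerA; apply: (sq_positiveZ LZ); first by rewrite invr_ge0 mulr_ge0// ltW.
  by rewrite scalerDl; have [_ h _] := hB i; exact: h.
- move=> j; case: insubP => [i _ _|_]; last first.
    by rewrite subr0 scale1r; exact: L_e_pos.
  have -> : 1 - t i = (2 * B i)^-1%:A * ((B i)%:A - xv i).
    have h : (2 * B i)^-1%:A * (2 * B i)%:A = 1 :> Rx.
      by rewrite -!in_algE -rmorphM mulVf ?mulf_neq0 ?gt_eqF// rmorph1.
    rewrite -[X in X - _]h /t -mulrBr; congr (_ * _).
    by rewrite -!in_algE rmorphM rmorph_nat; ring.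
  rewrite -scalerA; apply: (sq_positiveZ LZ); first by rewrite invr_ge0 mulr_ge0// ltW.
  by rewrite scalerBl; have [_ _ h] := hB i; exact: h.
- move=> i j /eqP ji; case: insubP => [i' _ i'E|]; last by rewrite ji ltn_ord.
  by have -> : i' = i by apply: val_inj; rewrite /= i'E ji.
Qed.

Section limit.
Variable f : nat -> Rx.
Hypothesis f_pos : forall j, sq_positive L (f j *: e).
Hypothesis f_pos1 : forall j, sq_positive L ((1 - f j) *: e).

Local Notation M := (mass L f).
Local Notation mean := (mean L e f).

Definition barycenter w : 'rV[R]_n * 'rV[R]_r :=
  (\row_i mean (x_ i) w, \row_k mean (l_ k) w).

Hypothesis X_approx : forall i, approximable L e f (xv i) (mean (x_ i)).

Lemma evalx_approx p : approximable L e f p (fun w => evalx p (barycenter w).1).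
Proof.
elim/mpoly_subring_ind: p => [c|i|p q hp hq|p q hp hq].
- under eq_fun do rewrite evalxC; rewrite -mpoly.alg_mpolyC.
  exact: approximable_cst.
- by under eq_fun do rewrite evalxXU mxE; exact: X_approx.
- under eq_fun do rewrite evalxD.
  exact: (approximableD LZ L_e_pos L_arch f_pos f_pos1 hp hq).
- under eq_fun do rewrite evalxM.
  exact: (approximableM LZ L_e_pos L_arch f_pos f_pos1 hp hq).
Qed.

(** The total error made at level [N] when [u] is evaluated at the barycenter of each branch. *)
Definition gap u N : R :=
  \sum_(w <- words N) `|M u w - M e w * evalV u (barycenter w)|.

(** When evaluation of [u] at barycenters is exact, the error for p u comes from p alone and
    [approximable_mass] applies. *)
Lemma gap_scale p u c :
  (forall w, M u w = M e w * c w) ->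
  (forall w, evalV u (barycenter w) = c w) ->
  gap (p *: u) @ \oo --> (0 : R).
Proof.
move=> hM hc.
have -> : gap (p *: u) = fun N => \sum_(w <- words N)
    `|M (p *: u) w - evalx p (barycenter w).1 * M u w|.
  apply/funext => N; apply: eq_bigr => w _.
  by rewrite evalVZ hc hM mulrCA.
exact: (approximable_mass LZ L_e_pos L_e1 L_arch f_pos f_pos1 u (evalx_approx p)).
Qed.

Lemma gapD u v : gap u @ \oo --> (0 : R) -> gap v @ \oo --> (0 : R) ->
  gap (u + v) @ \oo --> (0 : R).
Proof.
move=> hu hv.
have huv : (fun N => gap u N + gap v N) @ \oo --> (0 : R).
  by rewrite -[X in _ --> X](addr0 0); exact: cvgD.
apply: (squeeze_cvgr _ (cvg_cst 0) huv); near=> N.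
rewrite sumr_ge0//= -big_split /=; apply: ler_sum => w _.
rewrite evalVD /mass scalerDr raddfD mulrDr opprD addrACA.
exact: ler_normD.
Unshelve. all: by end_near. Qed.

(** Elements of V_r are affine in lambda, and evaluation at barycenters is exact for 1 and for each
    lambda_k by definition of the means; only the polynomial coefficients need approximation. *)
Lemma gap_cvg u : gap u @ \oo --> (0 : R).
Proof.
rewrite (VrE u); apply: gapD.
  rewrite in_VrE; apply: (@gap_scale _ _ (fun=> 1)) => w; first by rewrite mulr1.
  by rewrite evalV_in_Vr -mpoly.mpolyC1 evalxC.
apply: (big_ind (fun v => gap v @ \oo --> (0 : R))) => [||k _].
- rewrite (_ : gap 0 = fun=> 0); first exact: cvg_cst.
  apply/funext => N; apply: big1 => w _.
  by rewrite /mass scaler0 raddf0 evalV0 mulr0 subr0 normr0.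
- by move=> v w; exact: gapD.
- apply: (@gap_scale _ _ (mean (l_ k))) => w.
    by rewrite mulrC (mean_mass LZ L_e_pos L_arch f_pos f_pos1).
  by rewrite evalV_lam mxE.
Qed.

Lemma evalV_barycenter_bounded u :
  exists c, forall w, `|evalV u (barycenter w)| <= c.
Proof.
have hp p : exists c, forall w, `|evalx p (barycenter w).1| <= c.
  by case: (evalx_approx p).
have [c0 h0] := hp u.1.
have [c hc] := choice (fun k => hp (u.2 0 k)).
have hl k : exists c, forall w, `|mean (l_ k) w| <= c.
  by have [d _ hd] := ex_mean_bound LZ L_e_pos L_arch f_pos f_pos1 (l_ k); exists d.
have [d hd] := choice hl.
exists (c0 + \sum_(k < r) d k * c k) => w.
rewrite (le_trans (ler_normD _ _))// lerD//.
rewrite (le_trans (ler_norm_sum _ _ _))//; apply: ler_sum => k _.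
by rewrite normrM ler_pM// mxE.
Qed.

Hypothesis m_ge0 : forall w, 0 <= M e w.

Lemma sum_evalV_cvg u :
  (fun N => \sum_(w <- words N) M e w * evalV u (barycenter w)) @ \oo --> L u.
Proof.
apply/cvgrPdist_le => eps eps0.
have /cvgrPdist_le /(_ _ eps0) := gap_cvg u; apply: filterS => N.
rewrite sub0r normrN ger0_norm ?sumr_ge0//; apply: le_trans.
rewrite -(sum_mass L f u N) -sumrB; exact: ler_norm_sum.
Qed.

(** The quantity |v| - v is twice the negative part of v. As [M (g i) w] is nonnegative, a negative
    value at the barycenter is paid for by the gap. *)
Lemma sum_negative_part_cvg i :
  (fun N => \sum_(w <- words N) M e w *
     (`|evalV (g i) (barycenter w)| - evalV (g i) (barycenter w)))
    @ \oo --> (0 : R).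
Proof.
have g2 : (fun N => 2 * gap (g i) N) @ \oo --> (0 : R).
  rewrite -[X in _ --> X](mulr0 2); apply: cvgM; first exact: cvg_cst.
  exact: gap_cvg.
apply: (squeeze_cvgr _ (cvg_cst 0) g2); near=> N.
rewrite sumr_ge0 => [|w _]; last by rewrite mulr_ge0// subr_ge0 ler_norm.
rewrite andTb mulr_sumr; apply: ler_sum => w _.
have g0 : 0 <= M (g i) w.
  apply: (mass_ge0 LZ L_e_pos L_arch f_pos f_pos1).
  have [/(_ L_ge0)[_ gp] _] := quadratic_module_nonnegP y z g; exact: gp.
have mw := m_ge0 w.
set v := evalV _ _; have [v0|v0] := ger0P v; first by rewrite subrr mulr0 mulr_ge0.
have := ler_norm (M (g i) w - M e w * v); rewrite -/v.
by move: g0 mw v0; move: (M (g i) w) (M e w) v `|_| => a b c d *; lra.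
Unshelve. all: by end_near. Qed.

End limit.

End construction.

Lemma has_integral_limit d (T : measurableType d) (R : realType)
    (P : probability T R) (h : nat -> T -> R) (f : T -> R) (c l : R) (s : nat -> R) :
  (forall k, measurable_fun setT (h k)) -> measurable_fun setT f ->
  (forall k t, `|h k t| <= c) -> {ae P, forall t, h ^~ t @ \oo --> f t} ->
  (forall k, (\int[P]_t (h k t)%:E = (s k)%:E)%E) -> s @ \oo --> l ->
  has_integral P setT f l.
Proof.
move=> mh mf hc hf hs sl.
have [| | | | |intf _ If] := @dominated_convergence _ T R P setT measurableT
  (fun k t => (h k t)%:E) (EFin \o f) (cst c%:E).
- by move=> k; exact/measurable_EFinP.
- exact/measurable_EFinP.
- by apply: filterS hf => t ht _; apply: cvg_EFin => //; exact: nearW.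
- exact: finite_measure_integrable_cst.
- by apply: aeW => t k _; rewrite lee_fin; exact: hc.
split => //; move: If; rewrite (_ : (fun _ => _) = EFin \o s); last first.
  by apply/funext => k; exact: hs.
by move/cvg_unique; apply => //; apply: cvg_EFin => //; exact: nearW.
Qed.

(** * The limit point and its law *)

Section representation.
Variables (R : realType) (n r m : nat) (g : 'I_m -> Vr R n r).
Hypothesis g_arch : restricted_archimedean g.
Variables (y : mpoly.multinom n -> R) (z : 'I_r -> mpoly.multinom n -> R).
Hypothesis y0 : y mpoly.mnm0 = 1.
Hypothesis L_ge0 : forall p, quadratic_module g p -> 0 <= Lyz y z p.

Local Notation Rx := (mpoly.mpoly n R).
Local Notation Vr := (Vr R n r).
Local Notation L := (Lyz_additive y z).
Local Notation LZ := (LyzZ y z : forall c u, L (c%:A *: u) = c * L u).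
Local Notation e := (in_Vr r (1 : Rx)).
Local Notation x_ i := ((mpoly.mpolyX R (mpoly.mnm1 i) : Rx) *: e).
Local Notation l_ k := (lam R n k).

Lemma representing_measure_exists : exists rho, representing_measure g y z rho.
Proof.
have e_pos : sq_positive L e := L_e_pos L_ge0.
have e1 : L e = 1 := L_e1 z y0.
have arch := L_arch g_arch L_ge0.
have [f [t [B [fp fp1 ft xt]]]] := ex_splitting g_arch L_ge0.
have m_ge0 w : 0 <= mass L f e w by apply: (mass_ge0 LZ e_pos arch fp fp1).
have m_nil : mass L f e [::] = 1 by rewrite /mass branch_nil scale1r.
have m_split := mass_split L f e.
have X_approx i : approximable L e f (mpoly.mpolyX R (mpoly.mnm1 i)) (mean L e f (x_ i)).
  split.
    by have [c _ hc] := ex_mean_bound LZ e_pos arch fp fp1 (x_ i); exists c.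
  rewrite xt.
  exact: (deviation_mean LZ e_pos arch fp fp1 (ft i)
    (modn_trials (ltn_ord i) (fun=> erefl))).
(* The energies of all coordinates are added up so that one subsequence serves them all; each is
   nondecreasing, so its increments are at most those of the sum. *)
pose en N := \sum_i energy L e f (x_ i) N + \sum_k energy L e f (l_ k) N.
have nd_energy u : nondecreasing_seq (energy L e f u).
  exact: (energy_nondecreasing LZ e_pos arch fp fp1).
have en_nd : nondecreasing_seq en.
  by move=> N M NM; apply: lerD; apply: ler_sum => i _; exact: nd_energy.
have en_cvg : cvgn en.
  apply: is_cvgD.
  - apply/cvg_ex; exists (\sum_i limn (energy L e f (x_ i))).
    apply: cvg_big => [|i _]; first exact: add_continuous.
    exact: (energy_cvg LZ e_pos e1 arch fp fp1).
  - apply/cvg_ex; exists (\sum_k limn (energy L e f (l_ k))).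
    apply: cvg_big => [|k _]; first exact: add_continuous.
    exact: (energy_cvg LZ e_pos e1 arch fp fp1).
have [phi [phi_nd phi_ge phi_en]] := cvg_fast_subseq en_nd en_cvg.
pose P : probability (measurableTypeR R) R := uniform_prob (@ltr01 R).
pose S k : measurableTypeR R -> seq bool := random_word (mass L f e) (phi k).
have mS k (F : seq bool -> R) : measurable_fun setT (fun omega => F (S k omega)).
  exact: measurable_fun_random_word.
have intS k (F : seq bool -> R) : (\int[P]_omega (F (S k omega))%:E =
    (\sum_(w <- words (phi k)) mass L f e w * F w)%:E)%E.
  exact: integral_random_word.
have phi_infty : phi @ \oo --> \oo.
  by apply/cvgnyPge => N; exists N => // k /= Nk; exact: leq_trans (phi_ge k).
have mean_cvg u : (forall k, energy L e f u (phi k.+1) - energy L e f u (phi k) <=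
      en (phi k.+1) - en (phi k)) ->
    exists2 F : measurableTypeR R -> R, measurable_fun setT F &
      {ae P, forall omega, (fun k => mean L e f u (S k omega)) @ \oo --> F omega}.
  move=> hu; apply: (@ae_limit _ _ _ P (fun k omega => mean L e f u (S k omega))) => //.
  apply: (@ae_cvg_of_L2 _ _ _ P (fun k omega => mean L e f u (S k omega))) => // k.
  have pk : (phi k <= phi k.+1)%N by apply: phi_nd; exact: leqnSn.
  (* The coarser random word is a prefix of the finer one, so the squared increment is a function of
     the finer word alone and integrates to [increment]. *)
  pose D w := (mean L e f u w - mean L e f u (take (phi k) w)) ^+ 2.
  have -> : (\int[P]_omega ((mean L e f u (S k.+1 omega) -
      mean L e f u (S k omega)) ^+ 2)%:E = \int[P]_omega (D (S k.+1 omega))%:E)%E.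
    by apply: eq_integral => omega _; rewrite /D take_random_word.
  rewrite (intS k.+1 D) lee_fin -/(increment L e f u (phi k) (phi k.+1)).
  rewrite (incrementE LZ e_pos arch fp fp1)//.
  exact: le_trans (hu k) (phi_en k).
have nd_phi u k : 0 <= energy L e f u (phi k.+1) - energy L e f u (phi k).
  by rewrite subr_ge0; apply: nd_energy; apply: phi_nd; exact: leqnSn.
have en_diff k : en (phi k.+1) - en (phi k) =
    \sum_i (energy L e f (x_ i) (phi k.+1) - energy L e f (x_ i) (phi k)) +
    \sum_j (energy L e f (l_ j) (phi k.+1) - energy L e f (l_ j) (phi k)).
  by rewrite /en opprD addrACA -!sumrB.
have limX1 i : exists F : measurableTypeR R -> R, measurable_fun setT F /\
    {ae P, forall omega, (fun k => mean L e f (x_ i) (S k omega)) @ \oo --> F omega}.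
  have [|F mF hF] := mean_cvg (x_ i); last by exists F.
  move=> k; rewrite en_diff (bigD1 i)//= -addrA lerDl addr_ge0//.
    by apply: sumr_ge0.
  by apply: sumr_ge0.
have [X1 /all_and2[mX1 hX1]] := choice limX1.
have limX2 i : exists F : measurableTypeR R -> R, measurable_fun setT F /\
    {ae P, forall omega, (fun k => mean L e f (l_ i) (S k omega)) @ \oo --> F omega}.
  have [|F mF hF] := mean_cvg (l_ i); last by exists F.
  move=> k; rewrite en_diff [X in _ <= _ + X](bigD1 i)//= addrCA lerDl addr_ge0//.
    by apply: sumr_ge0.
  by apply: sumr_ge0.
have [X2 /all_and2[mX2 hX2]] := choice limX2.
pose X omega : 'rV[R]_n * 'rV[R]_r := (\row_i X1 i omega, \row_k X2 k omega).
have mX1' i : measurable_fun setT (fun omega => (X omega).1 0 i).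
  by under eq_fun do rewrite mxE; exact: mX1.
have mX2' i : measurable_fun setT (fun omega => (X omega).2 0 i).
  by under eq_fun do rewrite mxE; exact: mX2.
have X_cvg u : {ae P, forall omega,
    (fun k => evalV u (barycenter y z f (S k omega))) @ \oo --> evalV u (X omega)}.
  have h1 : {ae P, forall omega i,
      (fun k => mean L e f (x_ i) (S k omega)) @ \oo --> X1 i omega}.
    exact: filter_forall.
  have h2 : {ae P, forall omega i,
      (fun k => mean L e f (l_ i) (S k omega)) @ \oo --> X2 i omega}.
    exact: filter_forall.
  apply: filterS2 h1 h2 => omega h1 h2.
  apply: (@cvg_evalV _ _ _ (fun k => barycenter y z f (S k omega))) => i.
    by under eq_fun do rewrite mxE; rewrite mxE; exact: h1.
  by under eq_fun do rewrite mxE; rewrite mxE; exact: h2.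
have limitF (F : seq bool -> R) (G : measurableTypeR R -> R) c l :
    (forall w, `|F w| <= c) -> measurable_fun setT G ->
    {ae P, forall omega, (fun k => F (S k omega)) @ \oo --> G omega} ->
    (fun N => \sum_(w <- words N) mass L f e w * F w) @ \oo --> l ->
    has_integral P setT G l.
  move=> hc mG hG hl.
  apply: (@has_integral_limit _ _ _ P (fun k omega => F (S k omega)) G c l
    (fun k => \sum_(w <- words (phi k)) mass L f e w * F w)).
  - by move=> k; exact: mS.
  - exact: mG.
  - by move=> k omega; exact: hc.
  - exact: hG.
  - by move=> k; exact: intS.
  - exact: (cvg_comp phi _ phi_infty hl).
have evalV_integral u : has_integral P setT (fun omega => evalV u (X omega)) (L u).
  have [c hc] := evalV_barycenter_bounded g_arch L_ge0 fp fp1 X_approx u.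
  apply: (limitF _ _ c _ hc _ (X_cvg u)).
    exact: measurable_evalV.
  exact: sum_evalV_cvg.
have X_feasible : {ae P, forall omega, feasible_set g (X omega)}.
  apply: filter_forall => i.
  have [c hc] := evalV_barycenter_bounded g_arch L_ge0 fp fp1 X_approx (g i).
  (* A nonnegative function whose integral will be 0, as the limit of the averages in
     [sum_negative_part_cvg]. *)
  pose D (v : 'rV[R]_n * 'rV[R]_r) := `|evalV (g i) v| - evalV (g i) v.
  have mD : measurable_fun setT (fun omega => D (X omega)).
    have mV := measurable_evalV (g i) mX1' mX2'.
    by apply: measurable_funB => //; apply: measurableT_comp.
  have [_ I0] : has_integral P setT (fun omega => D (X omega)) 0.
    apply: (limitF (fun w => D (barycenter y z f w)) _ (2 * c)) => //.
    - move=> w; have := hc w; rewrite /D; set v := evalV _ _ => hv.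
      by rewrite (le_trans (ler_normB _ _))// normr_id; lra.
    - apply: filterS (X_cvg (g i)) => omega hX.
      by apply: cvgB => //; exact: cvg_norm.
    - exact: sum_negative_part_cvg.
  have : ae_eq P setT (EFin \o (fun omega => D (X omega))) (cst 0%E).
    apply/ae_eq_integral_abs => //; first exact/measurable_EFinP.
    rewrite -[RHS]I0; apply: eq_integral => omega _ /=.
    by rewrite ger0_norm// subr_ge0 ler_norm.
  apply: filterS => omega /(_ I) [] /eqP.
  by rewrite subr_eq0 => /eqP <-; exact: normr_ge0.
have [rho _ hrho] : exists2 rho : probability (borel ('rV[R]_n * 'rV[R]_r)%type) R,
    forall A, measurable A -> rho A = pushforward P (X : _ -> borel _) A
    & representing_measure g y z rho.
  apply: representing_pushforward => //.
  - move=> a; have := evalV_integral (mpoly.mpolyX R a *: e).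
    rewrite /= -in_VrE Lyz_in_Vr pairingX.
    by under eq_fun do rewrite evalV_in_Vr evalxX.
  - move=> k a; have := evalV_integral (mpoly.mpolyX R a *: l_ k).
    rewrite /= Lyz_lam pairingX.
    by under eq_fun do rewrite evalVZ evalxX evalV_lam.
by exists rho.
Qed.

End representation.

(** * Conditional expectations and disintegration *)

Section conditional_expectation.
Context d (T : measurableType d) (R : realType).

Lemma ex_density (mu : {finite_measure set T -> \bar R}) (w : T -> R) (c : R) :
  measurable_fun setT w -> (forall x, 0 <= w x <= c) ->
  exists nu : {finite_measure set T -> \bar R},
    forall A, nu A = (\int[mu]_(x in A) (w x)%:E)%E.
Proof.
move=> mw wc; pose nu A : \bar R := (\int[mu]_(x in A) (w x)%:E)%E.
have nu0 : nu set0 = 0%E by rewrite /nu integral_set0.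
have nu_ge0 A : (0 <= nu A)%E.
  by apply: integral_ge0 => x _; rewrite lee_fin; case/andP: (wc x).
have nu_sigma : semi_sigma_additive nu.
  apply: semi_sigma_additive_nng_induced; first exact/measurable_EFinP.
  by move=> x; rewrite lee_fin; case/andP: (wc x).
pose nuM : {measure set T -> \bar R} :=
  HB.pack nu (isMeasure.Build _ _ _ nu nu0 nu_ge0 nu_sigma).
have nu_fin : fin_num_fun nu.
  move=> A mA; apply: integrable_fin_num => //.
  apply: (integrableS measurableT) => //.
  apply: (@bounded_integrable _ _ _ mu _ c) => // x.
  by have /andP[w0 w1] := wc x; rewrite ger0_norm.
pose nuF : {finite_measure set T -> \bar R} :=
  HB.pack nu nuM (Measure_isFinite.Build _ _ _ nuM nu_fin).
by exists nuF.
Qed.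

(** The Radon-Nikodym derivative of [nu] has the same integrals as [w] over measurable sets, hence
    equals [w] almost everywhere; change of variables then applies. *)
Lemma ge0_integral_density (mu nu : {finite_measure set T -> \bar R}) (w : T -> R)
    (c : R) (f : T -> \bar R) :
  measurable_fun setT w -> (forall x, 0 <= w x <= c) ->
  (forall A, measurable A -> nu A = (\int[mu]_(x in A) (w x)%:E)%E) ->
  measurable_fun setT f -> (forall x, 0 <= f x)%E ->
  (\int[nu]_x f x = \int[mu]_x (f x * (w x)%:E))%E.
Proof.
move=> mw wc nuE mf f0.
have nu_mu : nu `<< mu.
  apply/null_content_dominatesP => A mA muA0; rewrite nuE//.
  apply: null_set_integral => //.
  by apply/measurable_EFinP; exact: measurable_funTS.
rewrite -(Radon_Nikodym_SigmaFinite.change_of_variables nu_mu)//.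
have iRN := Radon_Nikodym_SigmaFinite.f_integrable nu_mu.
have mRN := measurable_int _ iRN.
apply: ae_eq_integral => //.
- exact: emeasurable_funM.
- by apply: emeasurable_funM => //; exact/measurable_EFinP.
- apply: ae_eqe_mul2l; apply: integral_ae_eq => //; first exact/measurable_EFinP.
  by move=> A _ mA; rewrite -Radon_Nikodym_SigmaFinite.f_integral// nuE.
Qed.

Context d' (S : measurableType d').

Lemma ex_finite_pushforward (nu : {finite_measure set T -> \bar R})
    (X : {mfun T >-> S}) :
  exists nuX : {finite_measure set S -> \bar R}, forall A, nuX A = pushforward nu X A.
Proof.
pose m A := pushforward nu X A.
have m0 : m set0 = 0%E by exact: measure0.
have m_ge0 A : (0 <= m A)%E by exact: measure_ge0.
have m_sigma : semi_sigma_additive m by exact: measure_semi_sigma_additive.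
pose mM : {measure set S -> \bar R} := HB.pack m (isMeasure.Build _ _ _ m m0 m_ge0 m_sigma).
have m_fin : fin_num_fun m.
  move=> A mA; apply: fin_num_measure.
  by rewrite -[X in measurable X]setTI; exact: measurable_funPT.
pose mF : {finite_measure set S -> \bar R} :=
  HB.pack m mM (Measure_isFinite.Build _ _ _ mM m_fin).
by exists mF.
Qed.

(* The density, with respect to the law of [X], of the image under [X] of the
   measure of density [w]. *)
Lemma ge0_conditional_expectation (P : probability T R) (X : {mfun T >-> S})
    (w : T -> R) (c : R) :
  measurable_fun setT w -> (forall x, 0 <= w x <= c) ->
  exists tau : S -> R, [/\ measurable_fun setT tau, forall s, 0 <= tau s &
    forall f : S -> R, measurable_fun setT f -> (forall s, 0 <= f s) ->
      (\int[distribution P X]_s (f s * tau s)%:E =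
       \int[P]_x (f (X x) * w x)%:E)%E].
Proof.
move=> mw wc; have [nu0 nu0E] := ex_density P mw wc.
have mX : measurable_fun setT X by exact: measurable_funPT.
have [nu nuE] := ex_finite_pushforward nu0 X.
have nu_dom : nu `<< distribution P X.
  apply/null_content_dominatesP => A mA PA0.
  rewrite nuE /pushforward nu0E; apply: null_set_integral => //.
  - by rewrite -[X in measurable X]setTI; exact: mX.
  - by apply/measurable_EFinP; exact: measurable_funTS.
set g := Radon_Nikodym_SigmaFinite.f nu (distribution P X).
have g_fin := Radon_Nikodym_SigmaFinite.f_fin_num nu_dom.
have mg : measurable_fun setT g.
  exact: measurable_int (Radon_Nikodym_SigmaFinite.f_integrable nu_dom).
exists (fine \o g); split; first exact: measurableT_comp.
  by move=> s; rewrite /= fine_ge0// Radon_Nikodym_SigmaFinite.f_ge0.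
move=> f mf f0.
transitivity (\int[nu]_s (f s)%:E)%E.
  rewrite -(Radon_Nikodym_SigmaFinite.change_of_variables nu_dom)//; last first.
    exact/measurable_EFinP.
  by apply: eq_integral => s _; rewrite EFinM fineK.
transitivity (\int[pushforward nu0 X]_s (f s)%:E)%E.
  by apply: eq_measure_integral => A _ _; exact: nuE.
rewrite ge0_integral_pushforward//; last 2 first.
- exact/measurable_EFinP.
- by move=> s _; rewrite lee_fin; exact: f0.
rewrite preimage_setT (ge0_integral_density (mu := P) mw wc)//.
- by apply/measurable_EFinP; exact: measurableT_comp.
- by move=> x; rewrite lee_fin; exact: f0.
Qed.

(** Reduces to nonnegative data: [w] is shifted by its bound [c], and [f] is split into a difference
    of nonnegative functions. *)
Lemma conditional_expectation (P : probability T R) (X : {mfun T >-> S})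
    (w : T -> R) (c : R) :
  measurable_fun setT w -> (forall x, `|w x| <= c) ->
  exists2 tau : S -> R, measurable_fun setT tau &
    forall f : S -> R, measurable_fun setT f ->
      P.-integrable setT (fun x => (f (X x))%:E) ->
      (distribution P X).-integrable setT (fun s => (f s * tau s)%:E) /\
      (\int[distribution P X]_s (f s * tau s)%:E =
       \int[P]_x (f (X x) * w x)%:E)%E.
Proof.
move=> mw wc.
have mX : measurable_fun setT X by exact: measurable_funPT.
have wc2 x : 0 <= w x + c <= 2 * c.
  by have := wc x; rewrite ler_norml => /andP[? ?]; lra.
have mwc : measurable_fun setT (fun x => w x + c) by exact: measurable_funD.
have [tau [mtau tau0 htau]] := ge0_conditional_expectation P X mwc wc2.
exists (fun s => tau s - c); first exact: measurable_funB.
move=> f mf intf.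
set mu := distribution P X in htau *.
have intf_mu : mu.-integrable setT (EFin \o f).
  by apply: integrable_pushforward => //; exact/measurable_EFinP.
have nonneg (h : S -> R) : measurable_fun setT h -> (forall s, 0 <= h s) ->
    P.-integrable setT (fun x => (h (X x))%:E) ->
    P.-integrable setT (fun x => (h (X x) * (w x + c))%:E) /\
    mu.-integrable setT (fun s => (h s * tau s)%:E).
  move=> mh h0 inth.
  have ih : P.-integrable setT (fun x => (h (X x) * (w x + c))%:E).
    apply: (le_integrable measurableT _ _ (integrableZl measurableT (2 * c) inth)).
      apply/measurable_EFinP; apply: measurable_funM => //.
      exact: measurableT_comp.
    move=> x _; rewrite -EFinM !abse_EFin lee_fin [h _ * _]mulrC.
    have /andP[w0 w1] := wc2 x.
    rewrite (normrM (2 * c)) (normrM (w x + c)) ler_wpM2r// (ger0_norm w0) ger0_norm//.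
    exact: le_trans w1.
  split => //; apply/integrableP; split.
    by apply/measurable_EFinP; exact: measurable_funM.
  under eq_integral do rewrite abse_EFin ger0_norm ?mulr_ge0//.
  rewrite htau//.
  have /integrableP[_] := ih.
  under eq_integral => x _.
    have /andP[w0 _] := wc2 x.
    rewrite abse_EFin ger0_norm ?mulr_ge0//; over.
  by [].
(* Both functions are nonnegative and their difference is [f]. *)
pose h1 s := `|f s| + f s; pose h2 s := `|f s|.
have mh2 : measurable_fun setT h2 by exact: measurableT_comp.
have mh1 : measurable_fun setT h1 by exact: measurable_funD.
have h10 s : 0 <= h1 s by rewrite /h1; have := ler_norm (- f s); rewrite normrN; lra.
have h20 s : 0 <= h2 s by exact: normr_ge0.
have ih2 : P.-integrable setT (fun x => (h2 (X x))%:E) by exact: integrable_norm intf.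
have ih1 : P.-integrable setT (fun x => (h1 (X x))%:E).
  by under eq_fun do rewrite EFinD; exact: integrableD.
have [p1 q1] := nonneg _ mh1 h10 ih1.
have [p2 q2] := nonneg _ mh2 h20 ih2.
have Emu s : (f s * (tau s - c))%:E =
    ((h1 s * tau s)%:E - (h2 s * tau s)%:E - c%:E * (f s)%:E)%E.
  by rewrite -!EFinM -!EFinB /h1 /h2; congr EFin; ring.
have EP x : (f (X x) * w x)%:E =
    ((h1 (X x) * (w x + c))%:E - (h2 (X x) * (w x + c))%:E - c%:E * (f (X x))%:E)%E.
  by rewrite -!EFinM -!EFinB /h1 /h2; congr EFin; ring.
under eq_fun do rewrite Emu.
under [in RHS]eq_integral do rewrite EP.
have iZ := integrableZl measurableT c intf_mu.
have iZP := integrableZl measurableT c intf.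
split; first by apply: integrableB => //; exact: integrableB.
rewrite !integralB//; try exact: integrableB.
rewrite !htau// !integralZl//; congr (_ - _ * _)%E.
rewrite integral_pushforward//; exact/measurable_EFinP.
Qed.

End conditional_expectation.

(** * Linearity of integrals with prescribed values *)

Section has_integral.
Context d (T : measurableType d) (R : realType).
Variable mu : {measure set T -> \bar R}.

Lemma has_integral_negligibleP (D : set T) (f : T -> R) v :
  measurable D -> mu (~` D) = 0%E -> measurable_fun setT f ->
  has_integral mu D f v <-> has_integral mu setT f v.
Proof.
move=> mD D0 mf; have mEf : measurable_fun setT (EFin \o f) by exact/measurable_EFinP.
have DE : D = setT `\` ~` D by rewrite setTD setCK.
have mDC : measurable (~` D) by exact: measurableC.
have iffD : mu.-integrable setT (EFin \o f) <-> mu.-integrable D (EFin \o f).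
  by have := negligible_integrable mDC measurableT mEf D0; rewrite -DE.
split=> -[intf intfv].
  have intT := iffD.2 intf.
  split => //; rewrite (negligible_integral mDC measurableT intT D0).
  by rewrite -DE.
split; first exact/iffD.
by rewrite -intfv (negligible_integral mDC measurableT intf D0) -DE.
Qed.

Lemma has_integral_fine (f : T -> R) : mu.-integrable setT (EFin \o f) ->
  has_integral mu setT f (fine (\int[mu]_x (f x)%:E)).
Proof. by move=> intf; split => //; rewrite fineK//; exact: integrable_fin_num. Qed.

Lemma integrable_indicM (A : set T) (f : T -> R) : measurable A ->
  mu.-integrable setT (EFin \o f) ->
  mu.-integrable setT (fun x => (\1_A x * f x)%:E).
Proof.
move=> mA intf; apply: (le_integrable measurableT _ _ intf).
  apply/measurable_EFinP; apply: measurable_funM; first exact: measurable_indic.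
  exact/measurable_EFinP/(measurable_int _ intf).
move=> x _; rewrite !abse_EFin lee_fin normrM indicE.
by case: (x \in A); rewrite ?normr1 ?mul1r ?normr0 ?mul0r.
Qed.

Lemma has_integral0 : has_integral mu setT (cst 0) 0.
Proof.
split; first exact: integrable0.
by rewrite integral0.
Qed.

Lemma has_integralD f h a b : has_integral mu setT f a -> has_integral mu setT h b ->
  has_integral mu setT (fun x => f x + h x) (a + b).
Proof.
move=> [intf fa] [inth hb]; split; first exact: (integrableD measurableT intf inth).
by under eq_integral do rewrite EFinD; rewrite integralD// fa hb.
Qed.

Lemma has_integralZ c f a : has_integral mu setT f a ->
  has_integral mu setT (fun x => c * f x) (c * a).
Proof.
move=> [intf fa]; split; first exact: (integrableZl measurableT c intf).
by under eq_integral do rewrite EFinM; rewrite integralZl// fa.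
Qed.

Lemma has_integral_sum I (s : seq I) (f : I -> T -> R) (a : I -> R) :
  (forall i, has_integral mu setT (f i) (a i)) ->
  has_integral mu setT (fun x => \sum_(i <- s) f i x) (\sum_(i <- s) a i).
Proof.
move=> h; elim: s => [|i s IH].
  by under eq_fun do rewrite big_nil; rewrite big_nil; exact: has_integral0.
by under eq_fun do rewrite big_cons; rewrite big_cons; exact: has_integralD.
Qed.

End has_integral.

(** * Disintegration of a representing measure over its marginal *)

Section disintegration.
Variables (R : realType) (n r m : nat) (g : 'I_m -> Vr R n r).
Variables (y : mpoly.multinom n -> R) (z : 'I_r -> mpoly.multinom n -> R).
Local Notation Vec := ('rV[R]_n * 'rV[R]_r)%type.
Local Notation Rx := (mpoly.mpoly n R).
Local Notation Vr := (Vr R n r).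
Local Notation K := (feasible_set g).
Variable rho : probability (borel Vec) R.
Hypothesis rhoP : representing_measure g y z rho.

Lemma rho_monx a : has_integral rho setT (fun u => monx a u.1) (y a).
Proof.
have [K0 hy _] := rhoP.
apply/(has_integral_negligibleP _ (measurable_feasible_set g) K0) => //.
exact: measurable_monx.
Qed.

Lemma rho_monx_coord k a :
  has_integral rho setT (fun u => monx a u.1 * u.2 0 k) (z k a).
Proof.
have [K0 _ hz] := rhoP.
apply/(has_integral_negligibleP _ (measurable_feasible_set g) K0) => //.
by apply: measurable_funM; [exact: measurable_monx|exact: measurable_coord2].
Qed.

(** Extends from monomials by linearity; [c] is 1 for the sequence y and lambda_k for the sequences
    z. *)
Lemma has_integral_pairing (c : borel Vec -> R) (s : mpoly.multinom n -> R) :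
  (forall a, has_integral rho setT (fun u => monx a u.1 * c u) (s a)) ->
  forall p : Rx, has_integral rho setT (fun u => evalx p u.1 * c u) (pairing p s).
Proof.
move=> hs; elim/mpoly.mpolyind => [|b a p _ _ IH].
  under eq_fun do rewrite evalx0 mul0r.
  by rewrite pairing0; exact: has_integral0.
under eq_fun do rewrite evalxD -mpoly.mul_mpolyC evalxM evalxC evalxX mulrDl -mulrA.
rewrite pairingD pairingZ pairingX.
by apply: has_integralD => //; exact: has_integralZ.
Qed.

Lemma has_integral_evalx p : has_integral rho setT (fun u => evalx p u.1) (pairing p y).
Proof.
have := @has_integral_pairing (fun=> 1) y _ p; under eq_fun do rewrite mulr1.
by apply => a; under eq_fun do rewrite mulr1; exact: rho_monx.
Qed.

Lemma has_integral_evalV p : has_integral rho setT (evalV p) (Lyz y z p).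
Proof.
apply: has_integralD; first exact: has_integral_evalx.
apply: has_integral_sum => k; under eq_fun do rewrite mulrC.
by apply: has_integral_pairing => a; exact: rho_monx_coord.
Qed.

Lemma representing_normalized : y mpoly.mnm0 = 1.
Proof.
have [_] := rho_monx mpoly.mnm0.
under eq_integral do rewrite -evalxX mpoly.mpolyX0 -mpoly.mpolyC1 evalxC.
by rewrite integral_cst// mul1e => /esym; rewrite [X in _ = X](_ : _ = 1%E) => [[]|];
  [|exact: probability_setT].
Qed.

Lemma representing_nonneg p : quadratic_module g p -> 0 <= Lyz y z p.
Proof.
have [K0 _ _] := rhoP; move=> gp.
have mp : measurable_fun (setT : set (borel Vec)) (evalV p).
  apply: (@measurable_evalV _ _ _ _ (borel Vec) id) => i.
    exact: measurable_coord1.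
  exact: measurable_coord2.
have := has_integral_evalV p.
move/(has_integral_negligibleP _ (measurable_feasible_set g) K0 mp) => [_].
rewrite -lee_fin => <-; apply: integral_ge0 => u Ku; rewrite lee_fin.
exact: (quadratic_module_evalV_ge0 gp).
Qed.

Hypothesis g_arch : restricted_archimedean g.

Lemma feasible_bound p : exists2 c, 0 < c & forall u, K u -> `|evalV p u| <= c.
Proof.
have [N [N0 h1 h2]] := g_arch p; exists N => // u Ku.
have := quadratic_module_evalV_ge0 h1 Ku; have := quadratic_module_evalV_ge0 h2 Ku.
rewrite evalVB evalVD /cstV evalV_in_Vr evalxC => ? ?.
by rewrite ler_norml; apply/andP; split; lra.
Qed.

Lemma measurable_fst_borel :
  measurable_fun (setT : set (borel Vec)) (fst : borel Vec -> borel 'rV[R]_n).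
Proof.
apply: (@measurability _ _ (borel Vec) (borel 'rV[R]_n) _ _ (@open 'rV[R]_n)) => //.
move=> _ [U oU <-]; rewrite setTI; apply: sub_sigma_algebra.
have /continuousP fst_cont : continuous (fst : Vec -> 'rV[R]_n) by move=> u; exact: cvg_fst.
exact: fst_cont.
Qed.

Lemma disintegration : exists (mu : probability (borel 'rV[R]_n) R)
    (tau : 'I_r -> borel 'rV[R]_n -> R), graph_representation g y z mu tau.
Proof.
have [K0 _ _] := rhoP.
have mK := measurable_feasible_set g.
pose X : {mfun borel Vec >-> borel 'rV[R]_n} := HB.pack (fst : borel Vec -> borel 'rV[R]_n)
  (isMeasurableFun.Build _ _ _ _ _ measurable_fst_borel).
pose mu : probability (borel 'rV[R]_n) R := distribution rho X.
(* Cutting lambda_k off outside K makes it bounded everywhere without changing integrals, the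
   complement of K being null. *)
pose w k (u : borel Vec) : R := u.2 0 k * \1_K u.
have mw k : measurable_fun setT (w k).
  by apply: measurable_funM; [exact: measurable_coord2|exact: measurable_indic].
have w_bound k : exists c, forall u, `|w k u| <= c.
  have [c c0 hc] := feasible_bound (lam R n k).
  exists c => u; rewrite /w indicE; case: (boolP (u \in K)) => [|_].
    by rewrite inE => /hc; rewrite evalV_lam mulr1.
  by rewrite mulr0 normr0 ltW.
have ex_tau k : exists tau : borel 'rV[R]_n -> R, measurable_fun setT tau /\
    forall f : borel 'rV[R]_n -> R, measurable_fun setT f ->
      rho.-integrable setT (fun u => (f u.1)%:E) ->
      mu.-integrable setT (fun s => (f s * tau s)%:E) /\
      (\int[mu]_s (f s * tau s)%:E = \int[rho]_u (f u.1 * w k u)%:E)%E.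
  have [c hc] := w_bound k.
  by have [tau mtau htau] := conditional_expectation rho X (mw k) hc; exists tau.
have [tau /all_and2[mtau htau]] := choice ex_tau.
have m_coord i : measurable_fun (setT : set (borel 'rV[R]_n)) (fun x => x 0 i).
  apply: measurable_of_open_preimage; apply/continuousP; exact: coord_continuous.
have m_evalx p : measurable_fun (setT : set (borel 'rV[R]_n)) (evalx p).
  exact: (@measurable_evalx _ _ _ (borel 'rV[R]_n) id).
have m_evalx1 p : measurable_fun (setT : set (borel Vec)) (fun u => evalx p u.1).
  exact: (measurableT_comp (m_evalx p) measurable_fst_borel).
have int_tau k (f : borel 'rV[R]_n -> R) (s : R) : measurable_fun setT f ->
    rho.-integrable setT (fun u => (f u.1)%:E) ->
    has_integral rho setT (fun u => f u.1 * u.2 0 k) s ->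
    has_integral mu setT (fun x => f x * tau k x) s.
  move=> mf intf hs; have [i1 e1] := htau k f mf intf; split => //.
  have mfl : measurable_fun (setT : set (borel Vec)) (fun u => f u.1 * u.2 0 k).
    apply: measurable_funM; last exact: measurable_coord2.
    exact: (measurableT_comp mf measurable_fst_borel).
  have [_ <-] := (has_integral_negligibleP s mK K0 mfl).2 hs.
  rewrite e1 [RHS]integral_mkcond; apply: eq_integral => u _.
  by rewrite patchE /w indicE; case: (u \in K); rewrite ?mulr1// !mulr0.
have int_fst (f : borel 'rV[R]_n -> R) (s : R) : measurable_fun setT f ->
    has_integral rho setT (fun u => f u.1) s -> has_integral mu setT f s.
  move=> mf [intf intfs].
  have mEf : measurable_fun setT (EFin \o f) by exact/measurable_EFinP.
  split; first exact: (integrable_pushforward measurable_fst_borel mEf intf).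
  by rewrite (integral_pushforward measurable_fst_borel mEf intf).
have feas : {ae mu, forall x, K (graph tau x)}.
  apply: filter_forall => i.
  pose F x := evalV (g i) (graph tau x).
  have mF : measurable_fun setT F.
    apply: (@measurable_evalV _ _ _ _ (borel 'rV[R]_n) (graph tau)) => k //=.
    by under eq_fun do rewrite mxE; exact: mtau.
  (* The claim is that this bad set is null for mu. *)
  pose A := [set x | F x < 0].
  have mA : measurable A.
    have := mF measurableT `]-oo, 0[%classic (measurable_itv _); rewrite setTI.
    by congr measurable; apply/seteqP; split => x; rewrite /A /= in_itv.
  have mA1 : measurable ((fun u : borel Vec => u.1) @^-1` A).
    by rewrite -[X in measurable X]setTI; exact: measurable_fst_borel.
  have [p0 hp0] : exists s, has_integral rho setT
      (fun u => \1_A u.1 * evalx (g i).1 u.1) s.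
    eexists; apply: has_integral_fine.
    have [int0 _] := has_integral_evalx (g i).1.
    exact: (integrable_indicM mA1 int0).
  have hpk k : exists s, has_integral rho setT
      (fun u => \1_A u.1 * evalx ((g i).2 0 k) u.1 * u.2 0 k) s.
    eexists; apply: has_integral_fine.
    have [intk _] := has_integral_pairing (rho_monx_coord k) ((g i).2 0 k).
    have := integrable_indicM mA1 intk.
    by apply: eq_integrable => // u _ /=; rewrite mulrA.
  have [p hp] := choice hpk.
  have mAp q : measurable_fun (setT : set (borel 'rV[R]_n)) (fun x => \1_A x * evalx q x).
    by apply: measurable_funM => //; exact: measurable_indic.
  have intAp q : rho.-integrable setT (fun u => (\1_A u.1 * evalx q u.1)%:E).
    have [intq _] := has_integral_evalx q.
    exact: (integrable_indicM mA1 intq).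
  (* Because g_i is affine in lambda, the integral over [A] of g_i (x, tau (x)) under mu and that of
     g_i (x, lambda) under rho are both [s]; the second is nonnegative. *)
  pose s := p0 + \sum_k p k.
  have sF : has_integral mu setT (fun x => \1_A x * F x) s.
    have := has_integralD (int_fst _ _ (mAp (g i).1) hp0)
      (has_integral_sum (index_enum 'I_r)
        (fun k => int_tau k _ _ (mAp ((g i).2 0 k)) (intAp _) (hp k))).
    congr (has_integral _ _ _ _); apply/funext => x.
    rewrite /F /evalV /= mulrDr; congr (_ + _); rewrite mulr_sumr; apply: eq_bigr => k _.
    by rewrite mxE -mulrA [_ * tau k x]mulrC.
  have s0 : 0 <= s.
    have sG : has_integral rho setT (fun u => \1_A u.1 * evalV (g i) u) s.
      have := has_integralD hp0 (has_integral_sum (index_enum 'I_r) hp).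
      congr (has_integral _ _ _ _); apply/funext => u.
      rewrite /evalV /= mulrDr; congr (_ + _); rewrite mulr_sumr; apply: eq_bigr => k _.
      by rewrite -mulrA [_ * u.2 0 k]mulrC.
    have mG : measurable_fun (setT : set (borel Vec)) (fun u => \1_A u.1 * evalV (g i) u).
      have [/measurable_int/measurable_EFinP] := sG; exact.
    have [_ Gs] := (has_integral_negligibleP s mK K0 mG).2 sG.
    rewrite -lee_fin -Gs; apply: integral_ge0 => u Ku; rewrite lee_fin mulr_ge0//.
  (* On [A] the integrand is the opposite of its absolute value, so the latter has integral - s <=
     0. *)
  have [_ abs_s] : has_integral mu setT (fun x => -1 * (\1_A x * F x)) (-1 * s).
    exact: has_integralZ.
  have absE x : `|(\1_A x * F x)%:E|%E = (-1 * (\1_A x * F x))%:E.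
    rewrite abse_EFin indicE; case: (boolP (x \in A)) => [|_].
      by rewrite inE /A /= => Fx; rewrite mul1r mulN1r ltr0_norm.
    by rewrite mul0r mulr0 normr0.
  have : ae_eq mu setT (fun x => (\1_A x * F x)%:E) (cst 0%E).
    apply/ae_eq_integral_abs => //.
      apply/measurable_EFinP; apply: measurable_funM; last exact: mF.
      exact: measurable_indic.
    apply/eqP; rewrite eq_le integral_ge0 ?andbT//.
    by under eq_integral do rewrite absE; rewrite abs_s lee_fin mulN1r oppr_le0; exact: s0.
  apply: filterS => x /(_ I) [].
  rewrite indicE; case: (boolP (x \in A)) => [|].
    by rewrite inE /A /= mul1r => Fx Fx0; rewrite Fx0 ltxx in Fx.
  by rewrite notin_setE /A /= => /negP; rewrite -leNgt.
have m_monx a : measurable_fun (setT : set (borel 'rV[R]_n)) (monx a).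
  rewrite (_ : monx a = evalx (mpoly.mpolyX R a)) //.
  by apply/funext => x; rewrite evalxX.
exists mu, tau; split => //.
- have ex_B i : exists B, forall u, K u -> `|u.1 0 i| <= B.
    have [c _ hc] := feasible_bound (in_Vr r (mpoly.mpolyX R (mpoly.mnm1 i))).
    by exists c => u /hc; rewrite evalV_in_Vr evalxXU.
  have [B hB] := choice ex_B.
  (* The support lies in a product of segments that contains the projection of K. *)
  exists [set v : 'rV[R]_n | forall i, `[- B i, B i]%classic (v ord0 i)].
    by apply: (@rV_compact R n (fun i => `[- B i, B i]%classic)) => i; exact: segment_compact.
  set C := [set v | _].
  have mC : measurable (C : set (borel 'rV[R]_n)).
    rewrite (_ : C = \bigcap_(i in setT)
        (fun x : 'rV[R]_n => x 0 i) @^-1` `[- B i, B i]%classic).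
      apply: fin_bigcap_measurable => [|i _]; first exact: finite_finset.
      rewrite -[X in measurable X]setTI.
      exact: (m_coord i measurableT _ (measurable_itv _)).
    by apply/seteqP; split => v h i; [move=> _|]; exact: h.
  apply: (subset_measure0 _ (measurableC mK) _ K0).
    rewrite -[X in measurable X]setTI.
    exact: (measurable_fst_borel measurableT (measurableC mC)).
  move=> u /= nC Ku; apply: nC => i; rewrite /= in_itv /= -ler_norml.
  exact: hB.
- move=> k.
  have [c c0 hc] := feasible_bound (lam R n k).
  apply/andP; split; apply/mem_set => //=.
  rewrite /finite_norm unlock /Lnorm; case: ifPn => // _.
  apply: (@le_lt_trans _ _ c%:E); last exact: ltry.
  (* The bound for lambda_k on K transfers to tau_k because the graph lies in K almost
     everywhere. *)
  apply/ess_supP; apply: filterS feas => x /hc.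
  by rewrite evalV_lam mxE /= lee_fin.
- by move=> a; apply: int_fst; [exact: m_monx|exact: rho_monx].
- move=> k a; apply: int_tau; [exact: m_monx| |exact: rho_monx_coord].
  by have [] := rho_monx a.
Qed.

End disintegration.

Theorem theorem4p1 (R : realType) (n r m : nat) (g : 'I_m -> Vr R n r)
    (arch : restricted_archimedean g)
    (y : mpoly.multinom n -> R) (z : 'I_r -> mpoly.multinom n -> R) :
  let stmt_i := exists rho, representing_measure g y z rho in
  let stmt_ii := y (@mpoly.mnm0 n) = 1 /\
    (forall p, quadratic_module g p -> 0 <= Lyz y z p) in
  let stmt_iii := [/\ y (@mpoly.mnm0 n) = 1, psd_infinite (moment_matrix y)
    & forall i, psd_infinite (localizing_matrix (g i) y z)] in
  [/\ stmt_i <-> stmt_ii,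
      stmt_ii <-> stmt_iii,
      stmt_i -> exists (mu : probability (borel 'rV[R]_n) R)
                       (tau : 'I_r -> borel 'rV[R]_n -> R),
        graph_representation g y z mu tau /\
        forall (Rad : R) (C : 'I_r -> R),
          0 < Rad -> (forall k, 0 < C k) ->
          quadratic_module g (cstV n r Rad - in_Vr r (sqnormx R n)) ->
          (forall k, quadratic_module g (cstV n r (C k) + lam R n k) /\
                     quadratic_module g (cstV n r (C k) - lam R n k)) ->
          exists tau' : 'I_r -> borel 'rV[R]_n -> R,
            [/\ forall k, {ae mu, forall x, tau' k x = tau k x},
                graph_representation g y z mu tau'
              & forall k, {ae mu, forall x, `|tau' k x| <= C k}]
    & forall (mu : probability (borel 'rV[R]_n) R)
             (tau : 'I_r -> borel 'rV[R]_n -> R),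
        graph_representation g y z mu tau ->
        exists2 rho : probability (borel ('rV[R]_n * 'rV[R]_r)%type) R,
          forall A, measurable A -> rho A = pushforward mu (graph tau) A
        & representing_measure g y z rho].

Proof.
move=> stmt_i stmt_ii stmt_iii.
have i_ii : stmt_i -> stmt_ii.
  move=> [rho rhoP]; split; first exact: representing_normalized rhoP.
  exact: representing_nonneg rhoP.
have ii_i : stmt_ii -> stmt_i.
  by move=> [y0 L0]; exact: (representing_measure_exists arch y0 L0).
split.
- by split.
- have e_psd := psd_infinite_sq_positive (moment_matrixE y z).
  have g_psd i := psd_infinite_sq_positive (localizing_matrixE y z (g i)).
  split=> [[y0 /quadratic_module_nonnegP[e_pos g_pos]]|[y0 e_pos g_pos]].
    by split => [//||i]; [exact/e_psd|exact/g_psd].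
  split => //; apply/quadratic_module_nonnegP; split; first exact/e_psd.
  by move=> i; exact/g_psd.
- move=> [rho rhoP]; have [mu [tau mtP]] := disintegration rhoP arch.
  exists mu, tau; split => // Rad C _ _ _ hC; exists tau; split => //.
    by move=> k; exact: aeW.
  move=> k; have [hCp hCm] := hC k; have [_ _ _ _ feas] := mtP.
  apply: filterS feas => x Kx.
  have := quadratic_module_evalV_ge0 hCp Kx.
  have := quadratic_module_evalV_ge0 hCm Kx.
  rewrite evalVB evalVD /cstV evalV_in_Vr evalxC evalV_lam mxE => ? ?.
  by rewrite ler_norml; apply/andP; split; lra.
- move=> mu tau [_ mtau hy hz feas].
  apply: (@representing_pushforward R n r m g y z _ _ mu (graph tau)) => //.
  + move=> i; apply: measurable_of_open_preimage; apply/continuousP.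
    exact: coord_continuous.
  + move=> k /=; under eq_fun do rewrite mxE.
    by have /andP[/set_mem] := mtau k.
  + by move=> k a; under eq_fun do rewrite /= mxE; exact: hz.
Qed.
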